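(* Let $(G,H)=(\mathrm O_n(\overline{\mathbb F}),\mathrm O_m(\overline{\mathbb F})\times\mathrm O_{n-m}(\overline{\mathbb F}))$ with $0<m<n$ and let $0\le r\le\lfloor n/2\rfloor$. (1) If $r\le\min\{m,n-m\}$, the unique open $H$-orbit in $\mathrm{Gr}_G(r)$ is $\mathcal O(0,0,0,r)$. (2) If $\min\{m,n-m\}\le r\le\lfloor n/2\rfloor$, the unique open $H$-orbit in $\mathrm{Gr}_G(r)$ is $$\begin{cases}\mathcal O(0,\,r-m,\,0,\,m)&\text{if }\dim U\le\dim W,\\ \mathcal O(r-n+m,\,0,\,0,\,n-m)&\text{if }\dim U>\dim W.\end{cases}$$
   Context: $\overline{\mathbb F}$ is an algebraically closed field of characteristic $\neq2$, $V\simeq\overline{\mathbb F}^n$ has a nondegenerate symmetric bilinear form $B$, $V=U\oplus W$ with $U\perp W$, $\dim U=m$, $\dim W=n-m$. $G$ is the isometry group of $V$ and $H$ the product of the isometry groups of $U$ and $W$. $\mathrm{Gr}_G(r)$ is the projective variety of $r$-dimensional subspaces $S$ of $V$ with $S\perp S$; ''open'' refers to the Zariski topology. For a subspace $X$, $\mathrm{Rad}(X)=X\cap X^\perp$; $\mathbf P_US=(S+W)\cap U$, $\mathbf P_WS=(S+U)\cap W$. For $S\in\mathrm{Gr}_G(r)$: $r_U(S)=\dim(S\cap U)$, $r_W(S)=\dim(S\cap W)$, $a(S)=\dim\frac{\mathrm{Rad}(\mathbf P_US)}{S\cap U}=\dim\frac{\mathrm{Rad}(\mathbf P_WS)}{S\cap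 W}$, $b(S)=\dim\frac{\mathbf P_US}{\mathrm{Rad}(\mathbf P_US)}$. The 4-tuple $(r_U(S),r_W(S),a(S),b(S))$ determines the $H$-orbit of $S$; $\mathcal O(r_U,r_W,a,b)$ denotes the $H$-orbit with this 4-tuple. *)

(* Defs.v *)
From mathcomp Require Import all_boot all_algebra.
From mathcomp Require Import mpoly.

Set Implicit Arguments.
Unset Strict Implicit.
Unset Printing Implicit Defensive.

Import GRing.Theory.
Local Open Scope ring_scope.

Section PluckerCoordinates.

Variables (F : fieldType) (V : vectType F) (r : nat).

(* Plücker coordinates are indexed by the increasing sequences
   j_0 < ... < j_(r-1) of column indices. *)
Definition plucker_index : {set {ffun 'I_r -> 'I_(\dim {:V})}} :=
  [set f : {ffun 'I_r -> 'I_(\dim {:V})} |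
    [forall i : 'I_r, forall j : 'I_r, (i < j)%N ==> (f i < f j)%N]].

Definition coord_matrix (S : {vspace V}) : 'M[F]_(r, \dim {:V}) :=
  \matrix_(i, j) coord (vbasis {:V}) j (vbasis S)`_i.

(* Meant for \dim S = r.  Another basis of S multiplies all the coordinates by
   one nonzero scalar, and another basis of V changes them by an invertible
   linear map, so the vanishing loci below depend on neither choice. *)
Definition plucker (S : {vspace V}) (k : 'I_#|plucker_index|) : F :=
  \det (colsub (enum_val k) (coord_matrix S)).

End PluckerCoordinates.

Section IsotropicGrassmannian.

Variables (F : fieldType) (V : vectType F) (B : {symmetric V}).

Definition isotropic_gr (r : nat) (S : {vspace V}) : Prop :=
  \dim S = r /\ (S <= orthov B S)%VS.

(* Topology induced on the isotropic Grassmannian by the Zariski topology of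
   the projective space of the Plücker embedding. *)
Definition zariski_closed (r : nat) (X : {vspace V} -> Prop) : Prop :=
  exists P : {mpoly F[#|plucker_index V r|]} -> Prop,
    (forall p, P p -> exists d : nat, p \is d.-homog)
    /\ (forall S, X S <->
          isotropic_gr r S /\ forall p, P p -> p.@[plucker S] = 0).

Definition zariski_open (r : nat) (X : {vspace V} -> Prop) : Prop :=
  (forall S, X S -> isotropic_gr r S)
  /\ zariski_closed r (fun S => isotropic_gr r S /\ ~ X S).

Definition isometry_of (X : {vspace V}) (h : 'End(V)) : Prop :=
  (h @: X = X)%VS /\ {in X &, forall x y, B (h x) (h y) = B x y}.

Definition Rad (X : {vspace V}) : {vspace V} := (X :&: orthov B X)%VS.

Variables (U W : {vspace V}).

(* For V = U (+) W: the maps h_U (+) h_W with h_U, h_W isometries of U, W. *)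
Definition in_H (h : 'End(V)) : Prop := isometry_of U h /\ isometry_of W h.

Definition is_H_orbit (r : nat) (X : {vspace V} -> Prop) : Prop :=
  exists2 S, isotropic_gr r S
    & forall T, X T <-> exists2 h, in_H h & T = (h @: S)%VS.

Definition unique_open_H_orbit (r : nat) (X : {vspace V} -> Prop) : Prop :=
  [/\ is_H_orbit r X, zariski_open r X
    & forall Y, is_H_orbit r Y -> zariski_open r Y -> forall S, Y S <-> X S].

Definition projU (S : {vspace V}) : {vspace V} := ((S + W) :&: U)%VS.

Definition dim_rU (S : {vspace V}) : nat := \dim (S :&: U).
Definition dim_rW (S : {vspace V}) : nat := \dim (S :&: W).

(* Dimensions of quotients; see capv_sub_Rad_projU for the first one. *)
Definition dim_a (S : {vspace V}) : nat :=
  (\dim (Rad (projU S)) - \dim (S :&: U))%N.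
Definition dim_b (S : {vspace V}) : nat :=
  (\dim (projU S) - \dim (Rad (projU S)))%N.

Definition orbitO (r rU rW a b : nat) (S : {vspace V}) : Prop :=
  isotropic_gr r S
  /\ [/\ dim_rU S = rU, dim_rW S = rW, dim_a S = a & dim_b S = b].

Lemma capv_sub_Rad_projU (r : nat) (S : {vspace V}) :
  (U <= orthov B W)%VS -> isotropic_gr r S ->
  (S :&: U <= Rad (projU S))%VS.
Proof.
move=> UW [_ SS]; apply/subvP => x; rewrite memv_cap => /andP[xS xU].
rewrite /Rad /projU !memv_cap xU andbT (subvP (addvSl S W)) //=.
apply/mem_orthovP => y; rewrite memv_cap => /andP[/memv_addP[s sS [w wW ->]] _].
rewrite linearDr /= (orthovP SS) // (orthovP UW) //.
by rewrite addr0.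
Qed.

End IsotropicGrassmannian.

(* Main.v *)
Require Import Defs.
From HB Require Import structures.
From mathcomp Require Import all_boot all_algebra all_fingroup.
From mathcomp Require Import mpoly.
From mathcomp Require Import zify ring.
From Stdlib Require Import Classical.

(** By Cauchy-Binet, the condition that the form B(pr_U x, pr_U y) restricted
to S has rank at least r - k is the non-vanishing of one of the quadratic forms
det (M (A + N) M^T) in the Plücker coordinates of S, where A is the matrix of
that form, rank N <= k and the rows of M span S. When k = 0, or r - k = dim U,
this condition says that S is generic, that is, P_U S is nondegenerate and
dim (S cap W) = k. The case dim U > dim W follows by exchanging U and W.

A generic S has a basis e_i + sqrt(-1) f_i, x_j + sqrt(-1) y_j, where the e_i
are orthonormal in U and the f_i, x_j, y_j together are orthonormal in W.
Products of reflections act transitively on orthonormal families of a given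
length, so the generic subspaces form one H-orbit.

In the same way any two isotropic subspaces of dimension r are related by a
product of reflections. Moving all the mirrors linearly to one fixed vector
joins the two by a rational curve if the number of reflections is even, so two
open sets meet, hence two open orbits coincide. The parity can be corrected by
a reflection in a vector of U, which is in H: this takes care of the two
components of the Grassmannian when 2 r = n. *)

Set Implicit Arguments.
Unset Strict Implicit.
Unset Printing Implicit Defensive.

Import GRing.Theory.
Local Open Scope ring_scope.

(** * The Cauchy-Binet formula *)

Section CauchyBinet.

Variables r n : nat.

Definition increasing_ffun : {set {ffun 'I_r -> 'I_n}} :=
  [set f : {ffun 'I_r -> 'I_n} |
    [forall i : 'I_r, forall j : 'I_r, (i < j)%N ==> (f i < f j)%N]].

Lemma increasing_ffunP (f : {ffun 'I_r -> 'I_n}) :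
  reflect (forall i j : 'I_r, (i < j)%N -> (f i < f j)%N)
          (f \in increasing_ffun).
Proof.
rewrite inE; apply: (iffP forallP) => [H i j ij | H i].
  by move/forallP/(_ j)/implyP: (H i); apply.
by apply/forallP=> j; apply/implyP; apply: H.
Qed.

Lemma increasing_ffun_mono (f : {ffun 'I_r -> 'I_n}) :
  f \in increasing_ffun -> forall i j : 'I_r, (f i < f j)%N = (i < j)%N.
Proof.
move=> /increasing_ffunP H i j; case: (ltngtP i j) => [/H //|/H ji|/val_inj ->].
  by rewrite ltnNge ltnW.
by rewrite ltnn.
Qed.

Lemma increasing_ffun_inj (f : {ffun 'I_r -> 'I_n}) :
  f \in increasing_ffun -> injective f.
Proof.
move=> /increasing_ffun_mono H i j fij; apply: val_inj.
by have := H i j; have := H j i; rewrite fij ltnn; case: ltngtP.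
Qed.

Lemma increasing_perm_ge (p : 'S_r) :
  (forall i j : 'I_r, (i < j)%N -> (p i < p j)%N) ->
  forall i : 'I_r, (i <= p i)%N.
Proof.
move=> incp; suff: forall k (i : 'I_r), val i = k -> (k <= p i)%N.
  by move=> H i; apply: (H i i).
elim=> [//|k IHk] i ik; have kr : (k < r)%N by rewrite ltnW // -ik ltn_ord.
by apply: leq_ltn_trans (IHk (Ordinal kr) _) (incp _ _ _); rewrite //= ik.
Qed.

(** Both [p] and its inverse are increasing, so both dominate the identity by
    [increasing_perm_ge]. *)
Lemma increasing_perm_id (p : 'S_r) :
  (forall i j : 'I_r, (i < j)%N = (p i < p j)%N) -> p = 1%g.
Proof.
move=> incp; apply/permP=> i; rewrite perm1; apply/val_inj/eqP.
rewrite /= eqn_leq; apply/andP; split; last first.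
  by apply: increasing_perm_ge => ? ?; rewrite incp.
rewrite -{2}(permK p i) increasing_perm_ge // => j k.
by rewrite [in X in _ -> X]incp !permKV.
Qed.

(** An injective map factors uniquely as a permutation followed by an increasing map. The next two
    lemmas prove this, so that [perm_ffun] reindexes sums over injective maps. *)
Definition perm_ffun (gs : {ffun 'I_r -> 'I_n} * 'S_r) : {ffun 'I_r -> 'I_n} :=
  [ffun i => gs.1 (gs.2 i)].

Lemma perm_ffun_inj : {in setX increasing_ffun setT &, injective perm_ffun}.
Proof.
move=> [g s] [g' s']; rewrite !in_setX /= !in_setT !andbT => gi g'i /ffunP eqgs.
have {}eqgs i : g i = g' ((s^-1 * s')%g i).
  by have := eqgs (s^-1 i)%g; rewrite !ffunE /= permKV permM.
have /permP p1 : (s^-1 * s')%g = 1%g.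
  apply: increasing_perm_id => i j.
  by rewrite -(increasing_ffun_mono gi) !eqgs (increasing_ffun_mono g'i).
congr (_, _); first by apply/ffunP=> i; rewrite eqgs p1 perm1.
by apply/permP=> i; have := p1 (s i); rewrite permM permK perm1 => ->.
Qed.

Lemma perm_ffun_im :
  [set f : {ffun 'I_r -> 'I_n} | injectiveb f]
    = perm_ffun @: setX increasing_ffun setT.
Proof.
apply/setP=> f; rewrite inE; apply/idP/imsetP => [|[[g s]]]; last first.
  rewrite in_setX /= andbC => /andP[_ /increasing_ffun_inj gi ->].
  by apply/injectiveP=> i j; rewrite !ffunE /= => /gi /perm_inj.
move=> /injectiveP finj; pose leo (a b : 'I_n) := (a <= b)%N.
(* The increasing factor lists the values of [f] in sorted order; the permutation records the
   sorting. *)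
pose cf := [tuple f i | i < r]; pose t := sort_tuple leo cf.
have /tuple_permP[p tp] : perm_eq cf t by rewrite perm_sym perm_sort.
exists ([ffun i => tnth t i], p); last first.
  apply/ffunP=> i; rewrite !ffunE /=.
  have {}tp : cf = [tuple tnth t (p i)  | i < r] by apply: val_inj.
  by have := congr1 (fun u => tnth u i) tp; rewrite !tnth_mktuple.
rewrite in_setX in_setT andbT /=; apply/increasing_ffunP=> i j ij.
rewrite !ffunE ltn_neqAle; apply/andP; split.
  rewrite -[_ == _ :> nat]/(tnth t i == tnth t j).
  rewrite !(tnth_nth (f i)) nth_uniq ?size_tuple ?ltn_ord //.
    by rewrite neq_ltn ij.
  by rewrite sort_uniq map_inj_uniq ?enum_uniq.
have srt : sorted leo t.
  by apply: sort_sorted => a b; apply: leq_total.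
rewrite !(tnth_nth (f i)).
apply: (sorted_leq_nth (leT := leo)) (ltnW ij) => //; rewrite ?inE ?size_tuple
  //.
- by move=> a b c; apply: leq_trans.
- by move=> a; apply: leqnn.
Qed.

Variable R : comNzRingType.

(** Multilinearity expands the determinant over all maps [f]; a repeated value gives two equal rows,
    hence zero. The injective maps are grouped by their increasing factor, and the sum over the
    permutation is then the Leibniz expansion of a minor of [M]. *)
Theorem Cauchy_Binet (M : 'M[R]_(r, n)) (N : 'M[R]_(n, r)) :
  \det (M *m N) =
    \sum_(f in increasing_ffun) \det (colsub f M) * \det (rowsub f N).
Proof.
pose F (f : {ffun 'I_r -> 'I_n}) := (\prod_i M i (f i)) * \det (rowsub f N).
transitivity (\sum_f F f).
  rewrite /determinant.
  transitivity (\sum_(s : 'S_r) \sum_(f : {ffun 'I_r -> 'I_n})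
     (-1) ^+ s * \prod_i (M i (f i) * N (f i) (s i))).
    apply: eq_bigr => s _; rewrite -big_distrr /=; congr (_ * _).
    rewrite -(bigA_distr_bigA (fun i j => M i j * N j (s i))).
    by apply: eq_bigr => i _; rewrite mxE.
  rewrite exchange_big /=; apply: eq_bigr => f _; rewrite /F /determinant.
  rewrite big_distrr /=; apply: eq_bigr => s _; rewrite big_split /= mulrCA.
  by congr (_ * (_ * _)); apply: eq_bigr => i _; rewrite mxE.
rewrite (bigID (fun f : {ffun 'I_r -> 'I_n} => injectiveb f)) /=.
rewrite [X in _ + X]big1 => [|f /injectivePn[i [j nij fij]]]; last first.
  rewrite /F (determinant_alternate nij) ?mulr0 // => k.
  by rewrite !mxE fij.
rewrite addr0.
rewrite (eq_bigl (mem [set f : {ffun 'I_r -> 'I_n} | injectiveb f])); last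
  first.
  by move=> f; rewrite /= inE.
rewrite perm_ffun_im big_imset /=; last exact: perm_ffun_inj.
rewrite (eq_bigl (fun gs => (gs.1 \in increasing_ffun) && true)); last first.
  by case=> g s; rewrite in_setX in_setT.
rewrite -(pair_big (mem increasing_ffun) xpredT (fun g s => F (perm_ffun (g,
  s)))) /=.
apply: eq_bigr => g _; rewrite [\det (colsub g M)]/determinant big_distrl /=.
apply: eq_bigr => s _; rewrite /F.
(* Permuting the rows of the minor of [N] produces the sign needed in the Leibniz formula for the
   minor of [M]. *)
have -> : rowsub (perm_ffun (g, s)) N = row_perm s (rowsub g N).
  by apply/matrixP=> i j; rewrite !mxE ffunE.
rewrite row_permE det_mulmx det_perm mulrCA mulrA; congr (_ * _ * _).
by apply: eq_bigr => i _; rewrite !mxE ffunE.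
Qed.

End CauchyBinet.

(** * Plücker coordinates and rank conditions *)

Section PluckerForms.

Variables (F : fieldType) (V : vectType F) (r : nat).
Implicit Types (S : {vspace V}) (X : r.-tuple V).

Local Notation n := (\dim {:V}).
Local Notation b := (vbasis {:V}).

(** The analogue of [coord_matrix] for an arbitrary tuple. Along a curve of subspaces the chosen
    basis [vbasis] need not vary polynomially, while the image of a fixed basis can. *)
Definition tuple_matrix X : 'M[F]_(r, n) := \matrix_(i, j) coord b j X`_i.

Lemma coord_tuple_sum X (x : 'rV[F]_r) (j : 'I_n) :
  coord b j (\sum_i x 0 i *: X`_i) = (x *m tuple_matrix X) 0 j.
Proof.
by rewrite linear_sum mxE; apply: eq_bigr => i _; rewrite linearZ /= mxE.
Qed.

Lemma row_free_tuple_matrix X : free X -> row_free (tuple_matrix X).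
Proof.
move=> /freeP freeX; apply: inj_row_free => x xM0; apply/rowP=> i.
rewrite mxE; apply: (freeX (x 0)); apply/eqP.
rewrite -(passmx.rVof_eq0 (vbasisP {:V})); apply/eqP/rowP=> j.
by rewrite mxE coord_tuple_sum xM0 !mxE.
Qed.

Lemma coord_matrixE S (dimS : \dim S = r) :
  coord_matrix r S = tuple_matrix (tcast dimS (vbasis S)).
Proof. by apply/matrixP=> i j; rewrite !mxE val_tcast. Qed.

Lemma row_free_coord_matrix S : \dim S = r -> row_free (coord_matrix r S).
Proof.
move=> dimS; rewrite (coord_matrixE dimS) row_free_tuple_matrix // val_tcast.
exact: basis_free (vbasisP S).
Qed.

(** The constant is the determinant of the change of basis [P], nonzero because the coordinate
    matrix of [S] has rank r and factors through [P]. *)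
Lemma plucker_span S X : \dim S = r -> <<X>>%VS = S ->
  exists2 c, c != 0
    & forall k, plucker S k = c * \det (colsub (enum_val k) (tuple_matrix X)).
Proof.
move=> dimS spanX.
pose P : 'M[F]_r := \matrix_(i, j) coord X j (vbasis S)`_i.
have defP : coord_matrix r S = P *m tuple_matrix X.
  apply/matrixP=> i j; rewrite [LHS]mxE.
  have -> : (P *m tuple_matrix X) i j = (row i P *m tuple_matrix X) 0 j.
    by rewrite -row_mul [RHS]mxE.
  rewrite -coord_tuple_sum; congr (coord _ _ _).
  have: (vbasis S)`_i \in <<X>>%VS.
    by rewrite spanX vbasis_mem // mem_nth // size_tuple dimS.
  by move/coord_span=> {1}->; apply: eq_bigr => k _; rewrite !mxE.
exists (\det P).
  rewrite -unitfE -unitmxE -row_free_unit -row_leq_rank.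
  apply: leq_trans (mxrankM_maxl P (tuple_matrix X)); rewrite -defP.
  by rewrite (eqP (row_free_coord_matrix dimS)).
move=> k; rewrite /plucker defP.
have -> : colsub (enum_val k) (P *m tuple_matrix X)
    = P *m colsub (enum_val k) (tuple_matrix X).
  by apply/matrixP=> i j; rewrite !mxE; apply: eq_bigr => l _; rewrite !mxE.
by rewrite det_mulmx.
Qed.

Lemma meval_homog_scale m (p : {mpoly F[m]}) d (c : F) (v : 'I_m -> F) :
  p \is d.-homog -> p.@[fun i => c * v i] = c ^+ d * p.@[v].
Proof.
move=> /dhomogP p_homog; rewrite !mevalE big_distrr /= !big_seq.
apply: eq_bigr => mo /p_homog <-; rewrite mulrCA; congr (_ * _).
rewrite -[Measure.sort _ _]/(mdeg _) mdegE -prodrXr -big_split /=.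
by apply: eq_bigr => i _; rewrite exprMn.
Qed.

(** Two applications of Cauchy-Binet to det (M E M^T), with M the coordinate matrix of a subspace,
    give this form; its coefficients are the r x r minors of [E]. *)
Definition plucker_quadric (E : 'M[F]_n) : {mpoly F[#|plucker_index V r|]} :=
  \sum_(k < #|plucker_index V r|) \sum_(l < #|plucker_index V r|)
    \det (mxsub (enum_val k) (enum_val l) E) *: ('X_k * 'X_l).

Lemma plucker_quadric_homog E : plucker_quadric E \is 2.-homog.
Proof.
apply: rpred_sum => k _; apply: rpred_sum => l _; apply: rpredZ.
by apply: (@dhomogM _ _ _ 1 _ 1); rewrite dhomogX /= mdeg1.
Qed.

Lemma sum_enum_plucker_index (G : {ffun 'I_r -> 'I_n} -> F) :
  \sum_(f in increasing_ffun r n) G f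
    = \sum_(k < #|plucker_index V r|) G (enum_val k).
Proof. exact: big_enum_val. Qed.

Lemma plucker_quadric_eval E S :
  (plucker_quadric E).@[plucker S]
    = \det (coord_matrix r S *m E *m (coord_matrix r S)^T).
Proof.
rewrite -mulmxA Cauchy_Binet sum_enum_plucker_index /plucker_quadric.
rewrite raddf_sum /=; apply: eq_bigr => k _.
have -> : rowsub (enum_val k) (E *m (coord_matrix r S)^T)
    = rowsub (enum_val k) E *m (coord_matrix r S)^T.
  by apply/matrixP=> i j; rewrite !mxE; apply: eq_bigr => l _; rewrite !mxE.
rewrite Cauchy_Binet sum_enum_plucker_index raddf_sum /= big_distrr /=.
apply: eq_bigr => l _; rewrite mevalZ mevalM !mevalXU.
rewrite -[rowsub _ _^T]trmxK det_tr trmx_mxsub trmxK -/(plucker S l).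
rewrite mulrCA; congr (_ * (_ * _)).
by congr (\det _); apply/matrixP=> i j; rewrite !mxE.
Qed.

(** In the normal form of [G] under row and column operations, the missing diagonal ones are
    supplied by a matrix of rank m - rank [G]. *)
Lemma leq_rank_add_unitmx m k (G : 'M[F]_m) : (m <= \rank G + k)%N ->
  exists2 N : 'M[F]_m, (\rank N <= k)%N & G + N \in unitmx.
Proof.
move=> rG; exists (col_ebase G *m copid_mx (\rank G) *m row_ebase G).
  apply: leq_trans (mxrankM_maxl _ _) _; apply: leq_trans (mxrankM_maxr _ _) _.
  by rewrite rank_copid_mx ?rank_leq_row // leq_subLR.
rewrite -{1}(mulmx_ebase G) -mulmxDl -mulmxDr /copid_mx addrC subrK mulmx1.
by rewrite unitmx_mul col_ebase_unit row_ebase_unit.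
Qed.

(** Corank at most k means invertible after a perturbation of rank at most k. Perturbing the ambient
    matrix [A] rather than the Gram matrix gives quadrics that do not depend on [S]. *)
Lemma rank_quadric S (A : 'M[F]_n) k : \dim S = r ->
  let M := coord_matrix r S in
  (r <= \rank (M *m A *m M^T) + k)%N <->
  exists2 N : 'M[F]_n, (\rank N <= k)%N
    & (plucker_quadric (A + N)).@[plucker S] != 0.
Proof.
move=> dimS M; have [M' MM'] : exists M', M *m M' = 1%:M.
  exact/row_freeP/row_free_coord_matrix.
split=> [/leq_rank_add_unitmx[N rN GN]|[N rN]].
  (* The right inverse [M'] of [M] lifts a perturbation of the r x r Gram matrix to the ambient
     space. *)
  exists (M' *m N *m M'^T).
    apply: leq_trans (mxrankM_maxl _ _) _.
    exact: leq_trans (mxrankM_maxr _ _) _.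
  rewrite plucker_quadric_eval -unitfE -unitmxE -/M.
  rewrite mulmxDr mulmxDl !mulmxA MM' mul1mx -[_ *m M'^T *m _]mulmxA.
  by rewrite -trmx_mul MM' trmx1 mulmx1.
rewrite plucker_quadric_eval -unitfE -unitmxE -/M mulmxDr mulmxDl.
move=> /mxrank_unit rGN; rewrite -{1}rGN.
apply: leq_trans (mxrank_add _ _) _; rewrite leq_add2l.
apply: leq_trans rN; apply: leq_trans (mxrankM_maxl _ _) _.
exact: mxrankM_maxr.
Qed.

Lemma zariski_open_rank (B : {symmetric V}) (A : 'M[F]_n) k
    (X : {vspace V} -> Prop) :
  (forall S, X S <-> isotropic_gr B r S /\
     (r <= \rank (coord_matrix r S *m A *m (coord_matrix r S)^T) + k)%N) ->
  zariski_open B r X.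
Proof.
move=> defX; split=> [S /defX[] //|].
exists (fun p => exists2 N : 'M[F]_n, (\rank N <= k)%N
                 & p = plucker_quadric (A + N)).
split=> [p [N _ ->]|S]; first by exists 2; apply: plucker_quadric_homog.
split=> [[isoS notX]|[isoS zeroS]]; split=> //.
  move=> p [N rN ->]; apply/eqP/negPn/negP=> nz; apply: notX; apply/defX.
  by split=> //; apply/rank_quadric; [case: isoS | exists N].
move/defX=> [_ /rank_quadric-/(_ isoS.1)[N rN]] /eqP[].
by apply: zeroS; exists N.
Qed.

End PluckerForms.

(** * Orthonormal families and radicals *)

Section OrthonormalSequences.

Variables (F : fieldType) (V : vectType F) (B : {symmetric V}).
Implicit Types (x y z : V) (s t : seq V) (X S : {vspace V}).

Lemma formC x y : B x y = B y x.
Proof. by rewrite hermC expr0 mul1r. Qed.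

Lemma formDl x y z : B (x + y) z = B x z + B y z.
Proof. exact: linearDl. Qed.

Lemma formNl x y : B (- x) y = - B x y.
Proof. exact: linearNl. Qed.

Lemma formZl a x y : B (a *: x) y = a * B x y.
Proof. exact: linearZl_LR. Qed.

Lemma formDr x y z : B x (y + z) = B x y + B x z.
Proof. exact: linearDr. Qed.

Lemma formNr x y : B x (- y) = - B x y.
Proof. exact: linearNr. Qed.

Lemma formZr a x y : B x (a *: y) = a * B x y.
Proof. exact: linearZr_LR. Qed.

Definition formE := (formDl, formNl, formZl, formDr, formNr, formZr).

Lemma form_suml (I : Type) (s : seq I) (G : I -> V) y :
  B (\sum_(i <- s) G i) y = \sum_(i <- s) B (G i) y.
Proof. exact: linear_sumlz. Qed.

Lemma RadP X x :
  reflect (x \in X /\ {in X, forall y, B x y = 0}) (x \in Rad B X).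
Proof.
rewrite /Rad memv_cap; apply: (iffP andP) => [] [xX /mem_orthovP //].
Qed.

Lemma Rad0P X :
  Rad B X = 0%VS <-> {in X, forall x, {in X, forall y, B x y = 0} -> x = 0}.
Proof.
split=> [RX x xX xoX|RX].
  by apply/eqP; rewrite -memv0 -RX; apply/RadP.
by apply/eqP; rewrite -subv0; apply/subvP=> x /RadP[xX xoX]; rewrite memv0;
  apply/eqP/RX.
Qed.

Lemma mem_orthov_span s x :
  {in s, forall y, B x y = 0} -> x \in orthov B <<s>>.
Proof.
move=> xos; rewrite mem_orthov_sym; apply/span_subvP => y ys.
by rewrite mem_orthov1 formC xos.
Qed.

Lemma orthonormal_consP x s :
  orthonormal B (x :: s) <->
  [/\ B x x = 1, {in s, forall y, B x y = 0} & orthonormal B s].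
Proof.
rewrite /orthonormal /= andbT; split.
  case/andP=> /andP[/eqP-> ->] /andP[/allP xs ->]; split=> // y /xs /eqP //.
case=> -> xs /andP[-> ->]; rewrite eqxx !andbT.
by apply/allP=> y /xs /= ->.
Qed.

Lemma orthonormal_catP s t :
  orthonormal B (s ++ t) <->
  [/\ orthonormal B s, orthonormal B t & {in s & t, forall x y, B x y = 0}].
Proof.
elim: s => [|a s IH] /=; first by split=> [|[]].
split=> [/orthonormal_consP[aa as_ /IH[s1 t1 st]]|].
  split=> //.
    by apply/orthonormal_consP; split=> // y ys; rewrite as_ // mem_cat ys.
  move=> x y; rewrite inE => /predU1P[-> yt|]; last exact: st.
  by rewrite as_ // mem_cat yt orbT.
case=> /orthonormal_consP[aa as_ s1] t1 st; apply/orthonormal_consP; split=> //.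
  move=> y; rewrite mem_cat => /orP[/as_ //|yt].
  by apply: st; rewrite ?mem_head.
by apply/IH; split=> // x y xs; apply: st; rewrite inE xs orbT.
Qed.

Lemma orthonormal_free s : orthonormal B s -> free s.
Proof.
elim: s => [_|x s IH /orthonormal_consP[xx xs /IH sfree]]; first exact:
  nil_free.
rewrite free_cons sfree andbT; apply/negP=> xspan.
have /mem_orthovP/(_ x xspan)/eqP := mem_orthov_span xs.
by rewrite xx oner_eq0.
Qed.

Lemma dim_span_orthonormal s : orthonormal B s -> \dim <<s>> = size s.
Proof. by move/orthonormal_free/eqP. Qed.

Lemma orthonormal_map (f : V -> V) s :
  {in s &, forall x y, B (f x) (f y) = B x y} ->
  orthonormal B s -> orthonormal B (map f s).
Proof.
elim: s => [//|x s IH] fB /orthonormal_consP[xx xs s1] /=.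
apply/orthonormal_consP; split.
- by rewrite fB ?mem_head.
- by move=> _ /mapP[y ys ->]; rewrite fB ?mem_head ?xs // inE ys orbT.
- by apply: IH => // a b as_ bs; apply: fB; rewrite inE ?as_ ?bs orbT.
Qed.

Lemma orthonormal_sum (c : V -> F) s : orthonormal B s ->
  {in s, forall x, B (\sum_(y <- s) c y *: y) x = c x}.
Proof.
elim: s => [//|a s IH /orthonormal_consP[aa as_ s1]] x.
rewrite big_cons formDl formZl inE => /predU1P[->|xs].
  rewrite aa mulr1 form_suml big_seq big1 ?addr0 // => y ys.
  by rewrite formZl formC as_ ?mulr0.
by rewrite as_ // mulr0 add0r IH.
Qed.

Lemma orthonormal_split X s : orthonormal B s -> {subset s <= X} ->
  (X = <<s>> + (X :&: orthov B <<s>>))%VS.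
Proof.
move=> s1 sX; apply/eqP; rewrite eqEsubv; apply/andP; split; last first.
  by rewrite subv_add capvSl andbT; apply/span_subvP.
apply/subvP=> x xX; pose p := \sum_(y <- s) B x y *: y.
have ps : p \in <<s>>%VS.
  rewrite /p big_seq; apply: memv_suml => y ys.
  by rewrite memvZ // memv_span.
rewrite -[x](subrK p) addrC memv_add // memv_cap memvB //=; last first.
  by move: ps; apply/subvP/span_subvP.
apply: mem_orthov_span => y ys.
by rewrite formDl formNl orthonormal_sum // subrr.
Qed.

Lemma Rad_orthonormal_compl X s : orthonormal B s -> {subset s <= X} ->
  Rad B X = 0%VS -> Rad B (X :&: orthov B <<s>>) = 0%VS.
Proof.
move=> s1 sX /Rad0P RX; apply/Rad0P=> x /memv_capP[xX xs] xo.
apply: RX => // y; rewrite {1}(orthonormal_split s1 sX).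
move=> /memv_addP[y1 y1s [y2 y2X ->]].
by rewrite formDr (xo y2) // addr0; apply: (mem_orthovP xs).
Qed.

Lemma Rad_span_orthonormal s : orthonormal B s -> Rad B <<s>> = 0%VS.
Proof.
move=> s1; apply/Rad0P=> x xs xo.
have [c xE _] := free_span (orthonormal_free s1) xs.
rewrite xE big_seq big1 // => y ys.
by rewrite -(orthonormal_sum c s1 ys) -xE xo ?memv_span // scale0r.
Qed.

End OrthonormalSequences.

Lemma two_neq0 (R : nzRingType) : 2%N \notin [pchar R] -> (2%:R : R) != 0.
Proof. by rewrite inE. Qed.

(** * Orthonormal bases and isotropic subspaces over a closed field *)

Section ClosedField.

Variables (F : closedFieldType) (V : vectType F) (B : {symmetric V}).
Hypothesis char_F : 2%N \notin [pchar F].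
Variable im : F.
Hypothesis im2 : im * im = -1.
Implicit Types (x y z : V) (s t : seq V) (X S : {vspace V}).

Lemma im_neq0 : im != 0.
Proof.
apply/negP=> /eqP im0; move/eqP: im2.
by rewrite im0 mul0r eq_sym oppr_eq0 oner_eq0.
Qed.

Lemma sqrt_closed (a : F) : exists c, c * c = a.
Proof.
have [//|c] := @solve_monicpoly F 2 (fun i => if i is 0%N then a else 0).
by rewrite big_ord_recl big_ord1 expr0 mulr1 mul0r addr0 => <-; exists c.
Qed.

(** Polarization: if [B x x] vanished on all of [X], so would 2 [B x y], and [X] would be its own
    radical. *)
Lemma anisotropic_vector X : Rad B X = 0%VS -> X != 0%VS ->
  exists2 x, x \in X & B x x != 0.
Proof.
move=> /Rad0P RX X0; apply: NNPP => noX.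
have Bxx x : x \in X -> B x x = 0.
  by move=> xX; apply/eqP/negPn/negP=> nz; apply: noX; exists x.
case/negP: X0; rewrite -vpick0; apply/eqP/RX; first exact: memv_pick.
move=> y yX; set x := vpick X; have xX : x \in X by apply: memv_pick.
have := Bxx _ (memvD xX yX); rewrite !formE !Bxx // addr0 add0r (formC B y).
move/eqP; rewrite -mulr2n -mulr_natl mulf_eq0 (negPf (two_neq0 char_F)) /=.
by move/eqP.
Qed.

(** Gram-Schmidt: an anisotropic vector is normalized by a square root, and its orthogonal
    complement in [X] again has zero radical. *)
Lemma orthonormal_basis X : Rad B X = 0%VS ->
  exists s, orthonormal B s /\ <<s>>%VS = X.
Proof.
have [n] := ubnP (\dim X); elim: n X => // n IH X dimX RX.
have [->|X0] := eqVneq X 0%VS; first by exists [::]; rewrite span_nil.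
have [x xX xx] := anisotropic_vector RX X0.
have [c cc] := sqrt_closed (B x x).
have c0 : c != 0 by apply/eqP=> c0; rewrite -cc c0 mul0r eqxx in xx.
pose e := c^-1 *: x.
have ee : B e e = 1 by rewrite !formE -cc; field.
have e1 : orthonormal B [:: e] by apply/orthonormal_consP; split.
have eX : {subset [:: e] <= X} by move=> y /[!inE] /eqP ->; rewrite memvZ.
have Xe := orthonormal_split e1 eX.
have [||s [s1 sX]] := IH (X :&: orthov B <<[:: e]>>)%VS.
- rewrite -ltnS; apply: leq_trans dimX; rewrite ltnS.
  rewrite ltn_neqAle dimvS ?capvSl // andbT.
  rewrite (dimv_leqif_eq (capvSl _ _)) (sameP eqP capv_idPl); apply/negP.
  move=> /subvP/(_ e (eX _ (mem_head _ _)))/mem_orthovP/(_ e).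
  by rewrite ee memv_span ?mem_head // => /(_ isT)/eqP; rewrite oner_eq0.
- exact: Rad_orthonormal_compl.
exists (e :: s); split; last by rewrite span_cons sX -span_seq1 -Xe.
apply/orthonormal_consP; split=> // y ys.
have /memv_capP[_ /mem_orthovP/(_ e)] : y \in (X :&: orthov B <<[:: e]>>)%VS.
  by rewrite -sX memv_span.
by rewrite formC memv_span ?mem_head //; apply.
Qed.

(** For orthonormal x, y the vector x + [im] y is isotropic because 1 + [im]^2 = 0. Orthonormal
    families thus encode isotropic subspaces, which reduces transitivity on the latter to
    transitivity on the former. *)
Definition isozip s t : seq V := [seq p.1 + im *: p.2 | p <- zip s t].

Lemma isozip_cat s1 s2 t1 t2 : size s1 = size t1 ->
  isozip (s1 ++ s2) (t1 ++ t2) = isozip s1 t1 ++ isozip s2 t2.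
Proof. by move=> st; rewrite /isozip zip_cat // map_cat. Qed.

Lemma mem_isozip s t z : z \in isozip s t ->
  exists x y, [/\ x \in s, y \in t & z = x + im *: y].
Proof.
elim: s t => [|a s IH] [|b t] //=; rewrite inE => /predU1P[->|/IH[x [y []]]].
  by exists a, b; rewrite !mem_head.
by move=> xs yt ->; exists x, y; rewrite !inE xs yt !orbT.
Qed.

Lemma map_isozip (h : {linear V -> V}) s t :
  map h (isozip s t) = isozip (map h s) (map h t).
Proof.
elim: s t => [|a s IH] [|b t] //=; rewrite /isozip /= linearD linearZ /=.
by congr (_ :: _); apply: IH.
Qed.

(** The shape required by simultaneous induction on the two arguments of [isozip]. *)
Lemma orthonormal_cat_cons x y s t : orthonormal B ((x :: s) ++ (y :: t)) <->
  [/\ [/\ B x x = 1, B y y = 1 & B x y = 0],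
      {in s ++ t, forall z, B x z = 0}, {in s ++ t, forall z, B y z = 0}
    & orthonormal B (s ++ t)].
Proof.
split.
  case/orthonormal_catP=> /orthonormal_consP[xx xs s1].
  case/orthonormal_consP=> yy yt t1 st; split.
  - by split=> //; apply: st; rewrite mem_head.
  - move=> z; rewrite mem_cat => /orP[/xs //|zt].
    by apply: st; rewrite ?mem_head // inE zt orbT.
  - move=> z; rewrite mem_cat => /orP[zs|/yt //].
    by rewrite formC st ?mem_head // inE zs orbT.
  apply/orthonormal_catP; split=> // a b as_ bt.
  by apply: st; rewrite inE ?as_ ?bt orbT.
case=> [[xx yy xy] xo yo /orthonormal_catP[s1 t1 st]].
apply/orthonormal_catP; split.
- by apply/orthonormal_consP; split=> // z zs; apply: xo; rewrite mem_cat zs.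
- apply/orthonormal_consP; split=> // z zs; apply: yo.
  by rewrite mem_cat zs orbT.
move=> a b; rewrite !inE => /predU1P[->|as_] /predU1P[->|bt] //.
- by apply: xo; rewrite mem_cat bt orbT.
- by rewrite formC yo // mem_cat as_.
exact: st.
Qed.

Lemma isozip_isotropic s t : size s = size t -> orthonormal B (s ++ t) ->
  (<<isozip s t>> <= orthov B <<isozip s t>>)%VS.
Proof.
move=> sz st1; rewrite -orthogonalE; apply/orthogonalP.
elim: s t sz st1 => [|x s IH] [|y t] //= sz.
case: sz => sz /orthonormal_cat_cons[[xx yy xy] xo yo st1].
have z0 z : z \in isozip s t -> B (x + im *: y) z = 0.
  case/mem_isozip=> a [b [as_ bt ->]]; rewrite !formE.
  by rewrite !xo ?yo ?mem_cat ?as_ ?bt ?orbT // !(mulr0, addr0).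
move=> z z'; rewrite /isozip /= !inE -/(isozip s t).
move=> /predU1P[->|zst] /predU1P[->|z'st].
- by rewrite !formE (formC B y) xx yy xy !mulr0 addr0 add0r mulr1 im2 subrr.
- exact: z0.
- by rewrite formC z0.
exact: IH st1 _ _ zst z'st.
Qed.

Lemma dim_isozip s t : size s = size t -> orthonormal B (s ++ t) ->
  \dim <<isozip s t>> = size s.
Proof.
move=> sz st1; suff /eqP -> : free (isozip s t).
  by rewrite size_map size1_zip ?sz.
elim: s t sz st1 => [|x s IH] [|y t] // sz; first by rewrite nil_free.
case: sz => sz /orthonormal_cat_cons[[xx yy xy] xo yo st1].
rewrite /isozip /= free_cons -/(isozip s t) IH // andbT.
(* [x] is orthogonal to all the remaining vectors but pairs to 1 with [x + im *: y], which is
   therefore not in their span. *)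
apply/negP=> zst; have: x \in orthov B <<isozip s t>>.
  apply: mem_orthov_span => _ /mem_isozip[a [b [as_ bt ->]]].
  by rewrite !formE !xo ?mem_cat ?as_ ?bt ?orbT // mulr0 addr0.
move/mem_orthovP/(_ _ zst)/eqP.
by rewrite !formE xx xy mulr0 addr0 oner_eq0.
Qed.

(* Each isotropic vector k of a hyperbolic plane (k, l) is u + im v for the
   orthonormal pair u = k/2 + l, v = (k/2 - l)/im. *)
Lemma isotropic_isozip X S : Rad B X = 0%VS ->
  (S <= X)%VS -> (S <= orthov B S)%VS ->
  exists s t, [/\ size s = \dim S, size t = \dim S, {subset s ++ t <= X},
                  orthonormal B (s ++ t) & S = <<isozip s t>>%VS].
Proof.
have [n] := ubnP (\dim S); elim: n S X => // n IH S X dimS RX SX SS.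
have [->|S0] := eqVneq S 0%VS.
  by exists [::], [::]; rewrite dimv0 span_nil.
set k := vpick S; have kS : k \in S by apply: memv_pick.
have kX := subvP SX _ kS.
have k0 : k != 0 by rewrite vpick0.
have BS x y : x \in S -> y \in S -> B x y = 0 by apply/orthovP.
have kk : B k k = 0 by apply: BS.
have [l0 l0X kl0] : exists2 l, l \in X & B k l != 0.
  apply: NNPP => nol; move/Rad0P: RX => /(_ k kX) k_0; case/eqP: k0; apply: k_0.
  by move=> y yX; apply/eqP/negPn/negP=> nz; apply: nol; exists y.
have [l1 l1X kl1] : exists2 l, l \in X & B k l = 1.
  by exists ((B k l0)^-1 *: l0); rewrite ?memvZ // formZr mulVf.
have n2 := two_neq0 char_F; have nim := im_neq0.
have [l [lX kl ll]] : exists l, [/\ l \in X, B k l = 1 & B l l = 0].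
  (* Subtracting this multiple of the isotropic [k] keeps the pairing with [k] equal to 1 and
     cancels [B l1 l1]. *)
  exists (l1 - (B l1 l1 / 2%:R) *: k); rewrite memvB // ?memvZ //; split=> //.
    by rewrite !formE kl1 kk mulr0 subr0.
  rewrite !formE kk (formC B l1 k) kl1; set c := B l1 l1.
  by field.
pose u := 2%:R^-1 *: k + l; pose v := im^-1 *: (2%:R^-1 *: k - l).
have kuv : k = u + im *: v.
  rewrite /v scalerA mulfV // scale1r /u addrACA subrr addr0 -scalerDl.
  have -> : 2%:R^-1 + 2%:R^-1 = 1 :> F by field.
  by rewrite scale1r.
have imV : im^-1 * im^-1 = -1 by rewrite -invfM im2 invrN invr1.
have uu : B u u = 1 by rewrite !formE ll kl (formC B l k) kl kk; field; rewrite
  ?n2.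
have vv : B v v = 1.
  rewrite !formE ll kl (formC B l k) kl kk.
  transitivity (- (im^-1 * im^-1)); last by rewrite imV opprK.
  by field; rewrite n2 nim.
have uv : B u v = 0.
  by rewrite !formE ll kl (formC B l k) kl kk; field; rewrite n2 nim.
have uv1 : orthonormal B [:: u; v].
  apply/orthonormal_consP; split=> //.
    by move=> z /[!inE] /eqP ->.
  by apply/orthonormal_consP; split.
have uvX : {subset [:: u; v] <= X}.
  move=> z /[!inE] /orP[] /eqP ->; first by rewrite memvD // memvZ.
  by rewrite memvZ // memvB // memvZ.
set P := orthov B <<[:: u; v]>>.
(* Since [S] is isotropic, [x] pairs to 0 with [k], so only its pairing with [l] has to be
   cancelled, and a multiple of [k] does this inside [S]. *)
have decS x : x \in S -> x - B x l *: k \in (S :&: P)%VS.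
  move=> xS; rewrite memv_cap memvB ?memvZ //=.
  apply: mem_orthov_span => z /[!inE] /orP[] /eqP ->.
    by rewrite !formE kl kk (BS x k) //; ring.
  by rewrite !formE kl kk (BS x k) //; ring.
have kP : k \notin P.
  apply/negP=> /mem_orthovP/(_ u); rewrite memv_span ?mem_head // => /(_ isT).
  by rewrite !formE kl kk mulr0 add0r => /eqP; rewrite oner_eq0.
have [||||s [t [szs szt stX st1 defS']]] := IH (S :&: P)%VS (X :&: P)%VS.
- rewrite -ltnS; apply: leq_trans dimS; rewrite ltnS.
  rewrite ltn_neqAle dimvS ?capvSl // andbT.
  rewrite (dimv_leqif_eq (capvSl _ _)) (sameP eqP capv_idPl); apply/negP.
  by move=> /subvP/(_ k kS); apply/negP.
- exact: Rad_orthonormal_compl.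
- by rewrite capvS.
- apply/orthovP=> x y /memv_capP[xS _] /memv_capP[yS _]; exact: BS.
have defS : S = (<[k]> + (S :&: P))%VS.
  apply/eqP; rewrite eqEsubv subv_add -memvE kS capvSl !andbT.
  apply/subvP=> x xS; rewrite -[x](subrK (B x l *: k)) addrC memv_add ?decS //.
  by rewrite memvZ ?memv_line.
have dimSP : \dim S = (\dim (S :&: P)).+1.
  rewrite {1}defS dimv_disjoint_sum ?dim_vline ?k0 //.
  apply/eqP; rewrite -subv0; apply/subvP=> _ /memv_capP[/vlineP[c ->]].
  rewrite memv_cap => /andP[_ ckP]; rewrite memv0.
  have [->|c0] := eqVneq c 0; first by rewrite scale0r.
  by case/negP: kP; rewrite -[k](scalerK c0) memvZ.
have uvst z : z \in s ++ t -> B u z = 0 /\ B v z = 0.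
  move=> /stX /memv_capP[_ /mem_orthovP zP].
  by rewrite ![B _ z]formC !zP // memv_span // !inE eqxx ?orbT.
exists (u :: s), (v :: t); split=> /=.
- by rewrite szs dimSP.
- by rewrite szt dimSP.
- move=> z; rewrite inE mem_cat inE (orbCA (z \in s)) orbA -mem_cat.
  case/orP=> [zuv|/stX /memv_capP[] //].
  by apply: uvX; rewrite !inE.
- apply/orthonormal_cat_cons; split=> // z /uvst[] //.
by rewrite /isozip /= span_cons -/(isozip s t) -defS' -kuv.
Qed.

End ClosedField.

(** * Products of reflections and their transitivity *)

Section Reflections.

Variables (F : fieldType) (V : vectType F) (B : {symmetric V}).
Hypothesis char_F : 2%N \notin [pchar F].
Implicit Types (u v x y : V) (s t : seq V) (X S : {vspace V}).

(* The reflection in v multiplied by B v v, hence polynomial in v. *)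
Definition srefl_fun v x := B v v *: x - (2%:R * B x v) *: v.

Fact srefl_fun_is_linear v : linear (srefl_fun v).
Proof.
move=> a x y; rewrite /srefl_fun !formE scalerBr scalerDr !scalerA addrACA.
by rewrite -opprD -scalerDl; congr (_ *: _ + _ - _ *: _); ring.
Qed.

HB.instance Definition _ v :=
  GRing.isLinear.Build F V V *:%R (srefl_fun v) (srefl_fun_is_linear v).

Definition srefl v : 'End(V) := linfun (srefl_fun v).

Lemma sreflE v x : srefl v x = B v v *: x - (2%:R * B x v) *: v.
Proof. exact: lfunE. Qed.

Lemma srefl_form v x y : B (srefl v x) (srefl v y) = B v v ^+ 2 * B x y.
Proof. by rewrite !sreflE !formE (formC B v y); ring. Qed.

Lemma sreflK v x : srefl v (srefl v x) = B v v ^+ 2 *: x.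
Proof.
rewrite !sreflE !formE scalerBr !scalerA -addrA -opprD -scalerDl -expr2.
have -> : B v v * (2%:R * B x v) +
  2%:R * (B v v * B x v - 2%:R * B x v * B v v) = 0 by ring.
by rewrite scale0r subr0.
Qed.

Definition srefls s : 'End(V) := foldr (fun v g => (srefl v \o g)%VF) \1%VF s.

Definition refl v : 'End(V) := (B v v)^-1 *: srefl v.

Lemma reflE v x : B v v != 0 -> refl v x = x - (2%:R * B x v / B v v) *: v.
Proof.
move=> v0; rewrite scale_lfunE sreflE scalerBr scalerA mulVf // scale1r scalerA.
by rewrite mulrC.
Qed.

Definition refls s : 'End(V) := foldr (fun v g => (refl v \o g)%VF) \1%VF s.

Definition anisotropic s := all (fun v => B v v != 0) s.

Lemma limg_scale a (f : 'End(V)) S : a != 0 -> ((a *: f) @: S = f @: S)%VS.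
Proof.
move=> a0; apply/vspaceP=> y; apply/memv_imgP/memv_imgP=> [] [x xS ->].
  by exists (a *: x); rewrite ?memvZ // scale_lfunE linearZ.
by exists (a^-1 *: x); rewrite ?memvZ // scale_lfunE linearZ /= scalerA mulfV
  ?scale1r.
Qed.

(** Nonzero scalars do not affect images of subspaces, so the polynomial maps [srefls] may replace
    the isometries [refls] there. *)
Lemma refls_limg s S : anisotropic s -> (refls s @: S = srefls s @: S)%VS.
Proof.
elim: s => [//|v s IH] /= /andP[v0 /IH sS].
by rewrite !limg_comp sS limg_scale // invr_eq0.
Qed.

Lemma refl_form v x y : B v v != 0 -> B (refl v x) (refl v y) = B x y.
Proof. by move=> v0; rewrite !scale_lfunE !formE srefl_form; field. Qed.

Lemma refls_form s x y : anisotropic s -> B (refls s x) (refls s y) = B x y.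
Proof.
elim: s => [|v s IH] /=; first by rewrite !id_lfunE.
by case/andP=> v0 /IH <-; rewrite !comp_lfunE refl_form.
Qed.

Lemma refls_fix s x :
  anisotropic s -> {in s, forall v, B x v = 0} -> refls s x = x.
Proof.
elim: s => [|v s IH] /=; first by rewrite id_lfunE.
case/andP=> v0 s0 xs; rewrite comp_lfunE IH //; last first.
  by move=> w ws; rewrite xs // inE ws orbT.
by rewrite reflE // xs ?mem_head // mulr0 mul0r scale0r subr0.
Qed.

Lemma refls_mem X s x :
  anisotropic s -> {subset s <= X} -> x \in X -> refls s x \in X.
Proof.
elim: s => [|v s IH] /=; first by rewrite id_lfunE.
case/andP=> v0 s0 sX xX; have vX := sX _ (mem_head _ _).
rewrite comp_lfunE reflE // memvB ?memvZ //.
by apply: IH => // w ws; rewrite sX // inE ws orbT.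
Qed.

Lemma refls_cat s t : refls (s ++ t) = (refls s \o refls t)%VF.
Proof.
by elim: s => [|v s IH] /=; rewrite ?comp_lfun1l // IH comp_lfunA.
Qed.

Lemma anisotropic_cat s t : anisotropic (s ++ t) = anisotropic s && anisotropic
  t.
Proof. exact: all_cat. Qed.

(** The mirror x - y works if it is anisotropic, that is, if [B x y] is not 1. Otherwise x + y has
    square 4; its reflection sends x to -y, and the reflection in y corrects the sign. *)
Lemma unit_vectors_refls X x y : x \in X -> y \in X -> B x x = 1 -> B y y = 1 ->
  exists s, [/\ anisotropic s, {subset s <= X} & refls s x = y].
Proof.
move=> xX yX xx yy; have n2 := two_neq0 char_F; set c := B x y.
have [c1|c1] := eqVneq c 1; last first.
  have d : B (x - y) (x - y) = 2%:R * (1 - c).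
    by rewrite !formE (formC B y) xx yy -/c; ring.
  have nc : 1 - c != 0 by rewrite subr_eq0 eq_sym.
  have d0 : B (x - y) (x - y) != 0 by rewrite d mulf_neq0.
  exists [:: x - y]; split; first by rewrite /= d0.
    by move=> z /[!inE] /eqP ->; rewrite memvB.
  rewrite /= comp_lfunE id_lfunE reflE // d !formE xx -/c divff ?mulf_neq0 //.
  by rewrite scale1r opprB addrC subrK.
have d : B (x + y) (x + y) = 2%:R * 2%:R.
  by rewrite !formE (formC B y) xx yy -/c c1; ring.
have d0 : B (x + y) (x + y) != 0 by rewrite d mulf_neq0.
have y0 : B y y != 0 by rewrite yy oner_eq0.
exists [:: y; x + y]; split; first by rewrite /= d0 y0.
  by move=> z /[!inE] /orP[] /eqP -> //; rewrite memvD.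
rewrite /= !comp_lfunE id_lfunE (reflE _ d0) d !formE xx -/c c1 -[1 + 1]/2%:R.
rewrite divff ?mulf_neq0 // scale1r opprD addrA subrr add0r.
by rewrite reflE // !formE yy divr1 mulrN1 scaleNr opprK mulr2n scalerDl
  scale1r addKr.
Qed.

(** Once the first vector of [s] is moved to the first vector [y] of [t], the remaining mirrors are
    taken in the orthogonal complement of [y], so they fix [y]. *)
Lemma orthonormal_refls X s t : size s = size t ->
  orthonormal B s -> orthonormal B t ->
  {subset s <= X} -> {subset t <= X} ->
  exists a, [/\ anisotropic a, {subset a <= X} & map (refls a) s = t].
Proof.
elim: t s X => [|y t IH] [|x s] // X sz; first by exists [::].
case: sz => sz /orthonormal_consP[xx xs s1] /orthonormal_consP[yy yt t1] sX tX.
have [||a [a0 aX axy]] := @unit_vectors_refls X x y _ _ xx yy.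
- by rewrite sX ?mem_head.
- by rewrite tX ?mem_head.
pose Y := (X :&: orthov B <[y]>)%VS.
have memY z : z \in X -> B y z = 0 -> z \in Y.
  by move=> zX zy; rewrite memv_cap zX mem_orthov1 formC zy eqxx.
have [|||||c [c0 cY cst]] := IH (map (refls a) s) Y.
- by rewrite size_map.
- by apply: orthonormal_map s1 => u v _ _; rewrite refls_form.
- exact: t1.
- move=> _ /mapP[z zs ->]; apply: memY.
    by apply: refls_mem => //; rewrite sX // inE zs orbT.
  by rewrite -axy refls_form // xs.
- by move=> z zt; apply: memY; rewrite ?yt // tX // inE zt orbT.
exists (c ++ a); split.
- by rewrite anisotropic_cat c0.
- by move=> z; rewrite mem_cat => /orP[/cY/memv_capP[]|/aX].
rewrite /= refls_cat comp_lfunE axy; congr (_ :: _).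
  apply: refls_fix => // z /cY/memv_capP[_]; rewrite mem_orthov1 => /eqP.
  by rewrite formC.
by rewrite -cst -map_comp; apply: eq_map => z; rewrite comp_lfunE.
Qed.

End Reflections.

(** * Orthogonal decompositions and the group H *)

Section PerpDecomposition.

Variables (F : fieldType) (V : vectType F) (B : {symmetric V}).
Hypothesis B_nondeg : nondegenerate B.
Implicit Types (x y z : V) (U W S T : {vspace V}) (h : 'End(V)).

Definition perp_decomposition U W : Prop :=
  [/\ (U + W = fullv)%VS, (U :&: W = 0)%VS & (U <= orthov B W)%VS].

Lemma perp_decompositionC U W :
  perp_decomposition U W -> perp_decomposition W U.
Proof. by case=> UW UW0 oUW; split; rewrite 1?addvC 1?capvC 1?orthov_sym. Qed.

Lemma perp_decomposition_dim U W :
  perp_decomposition U W -> (\dim U + \dim W = \dim {:V})%N.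
Proof. by case=> UW UW0 _; rewrite -dimv_disjoint_sum ?UW. Qed.

Lemma form_perp U W x y :
  perp_decomposition U W -> x \in U -> y \in W -> B x y = 0.
Proof. by case=> _ _ /orthovP oUW; apply: oUW. Qed.

Lemma perp_decompositionP U W x : perp_decomposition U W ->
  exists u w, [/\ u \in U, w \in W & x = u + w].
Proof.
case=> UW _ _; have: x \in (U + W)%VS by rewrite UW memvf.
by case/memv_addP=> u uU [w wW xuw]; exists u, w.
Qed.

Lemma form_eq0 x : (forall y, B x y = 0) -> x = 0.
Proof.
move=> x0; apply/eqP; rewrite -memv0 -(eqP B_nondeg).
by apply/mem_orthovP=> y _.
Qed.

Lemma Rad_summand U W : perp_decomposition U W -> Rad B U = 0%VS.
Proof.
move=> dUW; apply/Rad0P=> x xU xo; apply: form_eq0 => y.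
have [u [w [uU wW ->]]] := perp_decompositionP y dUW.
by rewrite formDr xo // (form_perp dUW) // addr0.
Qed.

Section Isometries.

Variables (U W : {vspace V}).
Hypothesis dUW : perp_decomposition U W.

Lemma in_HC h : in_H B U W h -> in_H B W U h.
Proof. by case. Qed.

Lemma in_H_form h x y : in_H B U W h -> B (h x) (h y) = B x y.
Proof.
case=> [[hU hBU] [hW hBW]].
have [u [w [uU wW ->]]] := perp_decompositionP x dUW.
have [u' [w' [u'U w'W ->]]] := perp_decompositionP y dUW.
rewrite [h (u + w)]linearD [h (u' + w')]linearD !formE (hBU u u') // (hBW w w')
  //.
have hUm a : a \in U -> h a \in U by move=> aU; rewrite -hU memv_img.
have hWm a : a \in W -> h a \in W by move=> aW; rewrite -hW memv_img.
rewrite (form_perp dUW (hUm u uU) (hWm _ w'W)) (form_perp dUW uU w'W).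
rewrite ![B _ u']formC ![B _ (h u')]formC.
by rewrite (form_perp dUW (hUm _ u'U) (hWm _ wW)) (form_perp dUW u'U wW).
Qed.

(** A vector killed by [h] is orthogonal to everything, because [h] preserves the nondegenerate
    form. *)
Lemma in_H_lker0 h : in_H B U W h -> lker h == 0%VS.
Proof.
move=> hH; rewrite -subv0; apply/subvP=> x; rewrite memv_ker memv0 => /eqP hx0.
by apply/eqP/form_eq0=> y; rewrite -(in_H_form x y hH) hx0 linear0l.
Qed.

Lemma in_H_comp h h' : in_H B U W h -> in_H B U W h' -> in_H B U W (h \o h')%VF.
Proof.
move=> hH h'H; have hB x y : B ((h \o h')%VF x) ((h \o h')%VF y) = B x y.
  by rewrite !comp_lfunE !in_H_form.
case: hH h'H => [[hU _] [hW _]] [[h'U _] [h'W _]].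
by split; split; rewrite ?limg_comp ?h'U ?h'W // => x y _ _; apply: hB.
Qed.

Lemma in_H_inv h : in_H B U W h -> in_H B U W h^-1%VF.
Proof.
move=> hH; have h0 := in_H_lker0 hH.
have hB x y : B (h^-1%VF x) (h^-1%VF y) = B x y.
  by rewrite -(in_H_form _ _ hH) !lker0_lfunVK.
case: hH => [[hU _] [hW _]].
split; split; try by move=> x y _ _; apply: hB.
  by rewrite -{1}hU -limg_comp lker0_compVf // lim1g.
by rewrite -{1}hW -limg_comp lker0_compVf // lim1g.
Qed.

Lemma in_H_refls s :
  anisotropic B s -> {subset s <= U} -> in_H B U W (refls B s).
Proof.
move=> s0 sU; have B0 x y : x \in W -> y \in s -> B x y = 0.
  by move=> xW /sU yU; rewrite formC (form_perp dUW).
split; split; try by move=> x y _ _; apply: refls_form.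
  apply/eqP; rewrite eqEdim; apply/andP; split.
    by apply/subvP=> _ /memv_imgP[x xU ->]; apply: refls_mem.
  rewrite limg_dim_eq //; apply/eqP; rewrite -subv0; apply/subvP=> x.
  rewrite memv_cap memv_ker memv0 => /andP[_ /eqP x0]; apply/eqP/form_eq0=> y.
  by rewrite -(refls_form _ _ s0) x0 linear0l.
rewrite -[RHS]lim1g; apply: eq_in_limg => x xW; rewrite id_lfunE refls_fix //.
by move=> y ys; apply: B0.
Qed.

(** Rank-nullity for the projection of [S] to [U] along [W], read off from the dimensions of S + W
    and (S + W) + U. *)
Lemma dim_projU S : (\dim (projU U W S) + \dim (S :&: W) = \dim S)%N.
Proof.
have [UW UW0 _] := dUW; have dimUW := perp_decomposition_dim dUW.
have := dimv_sum_cap (S + W) U; have := dimv_sum_cap S W.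
rewrite -addvA (addvC W) UW addvf -/(projU U W S) -dimUW => e1 e2.
by clear -dimUW e1 e2; lia.
Qed.

End Isometries.

(** For k <= r this is the orbit with invariants (0, k, 0, r - k), by [orbitO_generic]. *)
Definition generic_isotropic U W r k S : Prop :=
  [/\ isotropic_gr B r S, Rad B (projU U W S) = 0%VS & \dim (S :&: W) = k].

End PerpDecomposition.

(** * Normal forms of generic subspaces; they form one H-orbit *)

Section Frames.

Variables (F : closedFieldType) (V : vectType F) (B : {symmetric V}).
Hypothesis char_F : 2%N \notin [pchar F].
Variable im : F.
Hypothesis im2 : im * im = -1.
Hypothesis B_nondeg : nondegenerate B.
Implicit Types (x y z : V) (U W S T : {vspace V}) (h : 'End(V)).

(** The [es] will be an orthonormal basis of P_U S, and the vectors of [isozip im xs ys] a basis of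
    the intersection of [S] with [W]. *)
Definition is_frame U W d k S : Prop := exists es fs xs ys,
  [/\ [/\ size es = d, size fs = d, size xs = k & size ys = k],
      {subset es <= U}, {subset fs ++ xs ++ ys <= W},
      orthonormal B es /\ orthonormal B (fs ++ xs ++ ys)
    & S = <<isozip im (es ++ xs) (fs ++ ys)>>%VS].

Section Orbit.

Variables (U W : {vspace V}).
Hypothesis dUW : perp_decomposition B U W.

Lemma frame_img d k h S :
  in_H B U W h -> is_frame U W d k S -> is_frame U W d k (h @: S).
Proof.
move=> hH [es [fs [xs [ys [[se sf sx sy] esU fxyW [e1 fxy1] ->]]]]].
have [[hU _] [hW _]] := hH.
exists (map h es), (map h fs), (map h xs), (map h ys).
rewrite !size_map -!map_cat; split=> //.
- by move=> _ /mapP[x /esU xU ->]; rewrite -hU memv_img.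
- by move=> _ /mapP[x /fxyW xW ->]; rewrite -hW memv_img.
- by split; apply: orthonormal_map => // x y _ _; apply: in_H_form hH.
by rewrite limg_span map_isozip.
Qed.

(** Mirrors in [U] move the [es] and fix [W]; mirrors in [W] move the joint family [fs ++ xs ++ ys]
    and fix [U]. The composite lies in H. *)
Lemma frame_transitive d k S T : is_frame U W d k S -> is_frame U W d k T ->
  exists2 h, in_H B U W h & T = (h @: S)%VS.
Proof.
case=> es [fs [xs [ys [[se sf sx sy] esU fxyW [e1 fxy1] ->]]]].
case=> es' [fs' [xs' [ys' [[se' sf' sx' sy'] es'U fxy'W [e'1 fxy'1] ->]]]].
have [|a [a0 aU aes]] := orthonormal_refls char_F _ e1 e'1 esU es'U.
  by rewrite se se'.
have [|b [b0 bW bfxy]] := orthonormal_refls char_F _ fxy1 fxy'1 fxyW fxy'W.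
  by rewrite !size_cat sf sf' sx sx' sy sy'.
pose h := (refls B a \o refls B b)%VF; exists h.
  apply: (in_H_comp dUW); first exact: (in_H_refls B_nondeg dUW).
  by apply: in_HC; apply: (in_H_refls B_nondeg (perp_decompositionC dUW)) b0 bW.
have hU x : x \in U -> h x = refls B a x.
  move=> xU; rewrite comp_lfunE (refls_fix b0) // => y /bW yW.
  exact: form_perp dUW _ _.
have hW x : x \in W -> h x = refls B b x.
  move=> xW; rewrite comp_lfunE (refls_fix a0) // => y /aU yU.
  by rewrite formC (form_perp dUW) // refls_mem.
have hes : map h es = es'.
  by rewrite -aes; apply/eq_in_map=> x /esU /hU.
have : map h (fs ++ xs ++ ys) = fs' ++ xs' ++ ys'.
  by rewrite -bfxy; apply/eq_in_map=> x /fxyW /hW.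
rewrite !map_cat => /eqP; rewrite eqseq_cat ?size_map ?sf ?sf' //.
case/andP=> /eqP hfs; rewrite eqseq_cat ?size_map ?sx ?sx' //.
case/andP=> /eqP hxs /eqP hys.
by rewrite limg_span map_isozip !map_cat hes hfs hxs hys.
Qed.

Lemma frame_exists d k : (d <= \dim U)%N -> (d + (k + k) <= \dim W)%N ->
  exists S, is_frame U W d k S.
Proof.
move=> dU dkW.
have [us [us1 defU]] := orthonormal_basis char_F (Rad_summand B_nondeg dUW).
have RW := Rad_summand B_nondeg (perp_decompositionC dUW).
have [ws [ws1 defW]] := orthonormal_basis char_F RW.
have sU : size us = \dim U by rewrite -defU (dim_span_orthonormal us1).
have sW : size ws = \dim W by rewrite -defW (dim_span_orthonormal ws1).
have take1 n s : orthonormal B s -> orthonormal B (take n s).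
  by rewrite -{1}(cat_take_drop n s) => /orthonormal_catP[].
(* The three families in [W] are consecutive blocks of lengths d, k, k of one orthonormal basis. *)
exists <<isozip im (take d us ++ take k (drop d ws))
                   (take d ws ++ take k (drop (d + k) ws))>>%VS.
exists (take d us), (take d ws), (take k (drop d ws)), (take k (drop (d + k)
  ws)).
have -> : take d ws ++ take k (drop d ws) ++ take k (drop (d + k) ws)
    = take (d + (k + k)) ws by rewrite takeD takeD drop_drop (addnC k d).
split=> //.
- by rewrite !size_takel ?size_drop ?sU ?sW //; lia.
- by move=> x /mem_take xus; rewrite -defU memv_span.
- by move=> x /mem_take xws; rewrite -defW memv_span.
by split; apply: take1.
Qed.

Lemma frame_generic d k S :
  is_frame U W d k S -> generic_isotropic B U W (d + k) k S.
Proof.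
case=> es [fs [xs [ys [[se sf sx sy] esU fxyW [e1 fxy1] defS]]]].
have efxy1 : orthonormal B ((es ++ xs) ++ (fs ++ ys)).
  have [f1 xy1 fxy0] := iffLR (orthonormal_catP _ _ _) fxy1.
  have [x1 y1 xy0] := iffLR (orthonormal_catP _ _ _) xy1.
  have eW u w : u \in es -> w \in fs ++ xs ++ ys -> B u w = 0.
    by move=> /esU uU /fxyW wW; apply: form_perp dUW _ _.
  apply/orthonormal_catP; split.
  - apply/orthonormal_catP; split=> // u w ue wx; apply: eW => //.
    by rewrite !mem_cat wx orbT.
  - apply/orthonormal_catP; split=> // u w uf wy; apply: fxy0 => //.
    by rewrite mem_cat wy orbT.
  move=> u w; rewrite !mem_cat => /orP[ue|ux] /orP[wf|wy].
  - by apply: eW; rewrite // !mem_cat wf.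
  - by apply: eW; rewrite // !mem_cat wy !orbT.
  - by rewrite formC; apply: fxy0; rewrite // mem_cat ux.
  exact: xy0.
have sz : size (es ++ xs) = size (fs ++ ys) by rewrite !size_cat se sf sx sy.
have dimS : \dim S = (d + k)%N by rewrite defS (dim_isozip im sz efxy1)
  size_cat se sx.
have isoS : isotropic_gr B (d + k) S.
  by split=> //; rewrite defS isozip_isotropic.
(* The lower bounds k here and d for P_U S add up to dim S, so [dim_projU] makes both of them
   equalities. *)
have leqk : (k <= \dim (S :&: W))%N.
  have [_ xy1 _] := iffLR (orthonormal_catP _ _ _) fxy1.
  have szxy : size xs = size ys by rewrite sx sy.
  rewrite -sx -(dim_isozip im szxy xy1).
  apply/dimvS/span_subvP=> z zxy; rewrite memv_cap defS isozip_cat ?se //.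
  rewrite memv_span ?mem_cat ?zxy ?orbT //=.
  have [x [y [xxs yys ->]]] := mem_isozip zxy.
  by rewrite memvD ?memvZ // fxyW // !mem_cat ?xxs ?yys !orbT.
have eP : (<<es>> <= projU U W S)%VS.
  apply/span_subvP=> e ees; rewrite memv_cap esU // andbT.
  have : e \in unzip1 (zip es fs) by rewrite unzip1_zip ?se ?sf.
  case/mapP=> -[e' f] ef /= defe; rewrite defe.
  have fW : f \in W.
    have: f \in unzip2 (zip es fs) by apply: map_f ef.
    by rewrite unzip2_zip ?se ?sf // => ffs; rewrite fxyW // mem_cat ffs.
  rewrite -[e'](addrK (im *: f)) memv_add ?memvN ?memvZ // defS isozip_cat ?se
    //.
  by rewrite memv_span // mem_cat (map_f (fun p => p.1 + im *: p.2) ef).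
have dimP := dim_projU dUW S.
have defP : projU U W S = <<es>>%VS.
  apply/esym/eqP; rewrite eqEdim eP (dim_span_orthonormal e1) se.
  by rewrite dimS in dimP; clear -dimP leqk; lia.
split=> //; first by rewrite defP (Rad_span_orthonormal e1).
by rewrite defP (dim_span_orthonormal e1) se dimS in dimP; clear -dimP; lia.
Qed.

(** An orthonormal basis of P_U S lifts to vectors e + [im] f(e) of [S], and isotropy makes f an
    isometry into [W]. What remains of [S] is its intersection with [W], an isotropic subspace of
    the nondegenerate complement of the f(e), where [isotropic_isozip] applies. *)
Lemma generic_frame r k S :
  generic_isotropic B U W r k S -> is_frame U W (r - k) k S.
Proof.
case=> [[dimS SS] RP dimSW]; have dimP := dim_projU dUW S.
have oS x y : x \in S -> y \in S -> B x y = 0 by apply/orthovP.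
have [es [e1 defP]] := orthonormal_basis char_F RP.
have sub_es e : e \in es -> e \in projU U W S.
  by move=> ee; rewrite -defP memv_span.
have esU : {subset es <= U} by move=> e /sub_es /memv_capP[].
(* [g] lifts a vector of P_U S to [S]; the factor [im] in [f] turns the sign in x = g(x) + w into
   [gE]. *)
pose g := addv_pi1 S W; pose f x := im *: addv_pi2 S W x.
have fW x : f x \in W by rewrite memvZ // memv_pi2.
have gS x : g x \in S by apply: memv_pi1.
have gE x : x \in projU U W S -> g x = x + im *: f x.
  case/memv_capP=> xSW _; rewrite /f scalerA im2 scaleN1r.
  by rewrite -{2}(addv_pi1_pi2 xSW) addrK.
clearbody f.
have gEs e : e \in es -> g e = e + im *: f e by move=> /sub_es /gE.
have eW e x : e \in es -> x \in W -> B e x = 0.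
  by move=> /esU eU xW; apply: form_perp dUW _ _.
have fB : {in es &, forall x y, B (f x) (f y) = B x y}.
  move=> x y xe ye; have := oS _ _ (gS x) (gS y).
  rewrite !gEs // !formE (eW x (f y)) // (formC B (f x) y) (eW y (f x)) //
    !mulr0 addr0 add0r.
  by rewrite mulrA im2 mulN1r => /eqP; rewrite subr_eq0 => /eqP.
have f1 : orthonormal B (map f es) by apply: orthonormal_map fB e1.
have fsW : {subset map f es <= W} by move=> _ /mapP[x _ ->].
have RW := Rad_summand B_nondeg (perp_decompositionC dUW).
have RX := Rad_orthonormal_compl f1 fsW RW.
have [||xs [ys [sx sy xyX xy1 defK]]] := isotropic_isozip char_F im2 (S := S
  :&: W) RX.
- rewrite subv_cap capvSr; apply/subvP=> x /memv_capP[xS xW].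
  apply: mem_orthov_span => _ /mapP[e ee ->].
  have := oS _ _ xS (gS e); rewrite gEs // !formE (formC B x e) eW // add0r.
  by move/eqP; rewrite mulf_eq0 (negPf (im_neq0 im2)) => /eqP.
- by apply/orthovP=> x y /memv_capP[xS _] /memv_capP[yS _]; apply: oS.
have size_es : size es = (r - k)%N.
  by rewrite -(dim_span_orthonormal e1) defP; lia.
exists es, (map f es), xs, ys; rewrite size_map size_es sx sy dimSW; split=> //.
- move=> x; rewrite mem_cat => /orP[/fsW //|/xyX].
  exact/subvP/capvSl.
- split=> //; apply/orthonormal_catP; split=> // x y xf /xyX /memv_capP[_].
  by rewrite formC => /mem_orthovP; apply; rewrite memv_span.
have zipg : isozip im es (map f es) = map g es.
  have : {subset es <= es} by [].
  elim: {1 3 4 5}es => [//|e s IH] ss /=; rewrite /isozip /= gEs ?ss ?mem_head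
    //.
  congr (_ :: _); apply: IH => x xs'; by rewrite ss // inE xs' orbT.
rewrite isozip_cat ?size_map // span_cat zipg -defK.
apply/eqP; rewrite eqEsubv; apply/andP; split; last first.
  by rewrite subv_add capvSl andbT; apply/span_subvP=> _ /mapP[e _ ->].
apply/subvP=> s sS; have [u [w [uU wW defs]]] := perp_decompositionP s dUW.
(* Subtracting from [s] the lift [g u] of its component in [U] leaves a vector of both [S] and
   [W]. *)
have uP : u \in projU U W S.
  rewrite memv_cap uU andbT -(addrK w u) -defs memv_add ?memvN //.
rewrite -[s](subrK (g u)) addrC memv_add //.
  by rewrite -limg_span memv_img // defP.
rewrite memv_cap memvB // defs gE // opprD addrACA subrr add0r.
by rewrite memvB // memvZ.
Qed.

Lemma generic_H_orbit r k :
  (k <= r)%N -> (r <= k + \dim U)%N -> (r + k <= \dim W)%N ->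
  is_H_orbit B U W r (generic_isotropic B U W r k).
Proof.
move=> kr rU rW; have [|| S frS] := @frame_exists (r - k) k; [lia|lia|].
have genS : generic_isotropic B U W r k S.
  by have := frame_generic frS; rewrite subnK.
exists S; first by case: genS.
move=> T; split=> [/generic_frame frT | [h hH ->]].
  exact: frame_transitive frS frT.
by have := frame_generic (frame_img hH frS); rewrite subnK.
Qed.

End Orbit.

End Frames.

(** * Openness of the generic locus *)

Section Openness.

(** Coordinates in the free family [X] identify the intersection with the left kernel of [G]. *)
Lemma dim_cap_solution_space (F : fieldType) (V : vectType F) r
    (X : r.-tuple V) (Z : {vspace V}) (G : 'M[F]_r) :
  free X ->
  (forall x : 'rV_r, \sum_i x 0 i *: X`_i \in Z <-> x *m G = 0) ->
  \dim (<<X>> :&: Z) = (r - \rank G)%N.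
Proof.
move=> /freeP freeX XZ; rewrite -mxrank_ker; set d := \rank _.
pose K : 'M_(d, r) := row_base (kermx G).
have KG0 : K *m G = 0 by apply/sub_kermxP; rewrite eq_row_base.
pose Y := [tuple \sum_j K i j *: X`_j | i < d].
have sumY (c : 'rV_d) : \sum_i c 0 i *: Y`_i = \sum_j (c *m K) 0 j *: X`_j.
  under eq_bigr => i _ do rewrite -tnth_nth tnth_mktuple scaler_sumr.
  rewrite exchange_big /=; apply: eq_bigr => j _; rewrite mxE scaler_suml.
  by apply: eq_bigr => i _; rewrite scalerA.
have freeY : free Y.
  apply/freeP=> k kY0 i; pose c := \row_i k i.
  have cK0 : c *m K = 0 *m K.
    rewrite mul0mx; apply/rowP=> j; rewrite [RHS]mxE.
    apply: (freeX (fun j => (c *m K) 0 j)); rewrite -sumY -[RHS]kY0.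
    by apply: eq_bigr => l _; rewrite mxE.
  have /rowP/(_ i) := row_free_inj (row_base_free (kermx G)) cK0.
  by rewrite !mxE.
suff -> : (<<X>> :&: Z)%VS = <<Y>>%VS by rewrite (eqP freeY) size_tuple.
apply/eqP; rewrite eqEsubv; apply/andP; split.
  apply/subvP=> z /memv_capP[/coord_span zX zZ].
  pose x := \row_i coord X i z.
  have zx : z = \sum_i x 0 i *: X`_i.
    by rewrite {1}zX; apply: eq_bigr => i _; rewrite mxE.
  move: zZ; rewrite {1}zx => /XZ /sub_kermxP; rewrite -(eq_row_base (kermx G)).
  case/submxP=> c xc; rewrite zx xc -sumY; apply: memv_suml => i _.
  by rewrite memvZ // memv_span // mem_nth // size_tuple.
apply/span_subvP=> y /tnthP[i ->]; rewrite tnth_mktuple.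
have KiE : \sum_j K i j *: X`_j = \sum_j (row i K) 0 j *: X`_j.
  by apply: eq_bigr => j _; rewrite [in RHS]mxE.
rewrite memv_cap; apply/andP; split.
  by apply: memv_suml => j _; rewrite memvZ // memv_span // mem_nth //
    size_tuple.
by rewrite KiE; apply/XZ; rewrite -row_mul KG0 row0.
Qed.

Variables (F : fieldType) (V : vectType F) (B : {symmetric V}).
Variables (U W : {vspace V}).
Hypothesis dUW : perp_decomposition B U W.
Implicit Types (S : {vspace V}).

Local Notation n := (\dim {:V}).
Local Notation b := (vbasis {:V}).

(** The matrix of B(pr_U x, pr_U y); as [U] and [W] are orthogonal, it suffices to project one
    argument. *)
Definition projU_form_mx : 'M[F]_n :=
  \matrix_(k, l) B b`_k (daddv_pi U W b`_l).

Lemma coord_matrix_projU_form r S (i j : 'I_r) : \dim S = r ->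
  (coord_matrix r S *m projU_form_mx *m (coord_matrix r S)^T) i j
    = B (vbasis S)`_i (daddv_pi U W (vbasis S)`_j).
Proof.
move=> dimS; rewrite [in RHS](coord_vbasis (memvf (vbasis S)`_j)).
rewrite [in RHS](coord_vbasis (memvf (vbasis S)`_i)).
rewrite linear_sum [RHS]linear_sumr mxE; apply: eq_bigr => l _.
rewrite linearZ /= formZr form_suml !mxE mulrC; congr (_ * _).
by apply: eq_bigr => k _; rewrite !mxE formZl.
Qed.

(** The projection maps [S] onto P_U S, so this intersection is the radical of the projected form on
    [S], the left kernel of its Gram matrix. *)
Lemma rank_projU_form r S : \dim S = r ->
  \dim (S :&: orthov B (projU U W S))
    = (r - \rank (coord_matrix r S *m projU_form_mx *m (coord_matrix r S)^T))%N.
Proof.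
move=> dimS; set G := _ *m _ *m _; pose X := tcast dimS (vbasis S).
have XE i : X`_i = (vbasis S)`_i by rewrite val_tcast.
have spanX : <<X>>%VS = S by rewrite val_tcast (span_basis (vbasisP S)).
rewrite -{1}spanX; apply: dim_cap_solution_space.
  by rewrite val_tcast; apply: basis_free (vbasisP S).
have [UW UW0 _] := dUW.
have pi_proj s : s \in S -> daddv_pi U W s \in projU U W S.
  move=> sS; rewrite memv_cap memv_pi andbT.
  have sUW : s \in (U + W)%VS by rewrite UW memvf.
  rewrite -[daddv_pi U W s](addrK (daddv_pi W U s)) daddv_pi_add //.
  by rewrite memv_add // memvN memv_pi.
have pi0 w : w \in W -> daddv_pi U W w = 0.
  move=> wW; have wUW : w \in (U + W)%VS by rewrite UW memvf.
  apply: (addIr w); rewrite add0r -{2}(daddv_pi_id (U := W) (V := U) _ wW)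
    1?capvC //.
  exact: daddv_pi_add.
have proj_pi y : y \in projU U W S -> exists2 s, s \in S & y = daddv_pi U W s.
  case/memv_capP=> /memv_addP[s sS [w wW ->]] swU; exists s => //.
  by rewrite -[LHS](daddv_pi_id UW0) // linearD /= (pi0 w) // addr0.
move=> x; set v := \sum_i _.
have xG j : (x *m G) 0 j = B v (daddv_pi U W (vbasis S)`_j).
  rewrite mxE form_suml; apply: eq_bigr => i _.
  by rewrite formZl coord_matrix_projU_form // XE.
split=> [/mem_orthovP vP | xG0].
  apply/rowP=> j; rewrite xG mxE vP // pi_proj // vbasis_mem // mem_nth //.
  by rewrite size_tuple dimS.
apply/mem_orthovP=> _ /proj_pi[s sS ->].
rewrite (coord_vbasis sS) linear_sum linear_sumr big1 // => j _.
rewrite linearZ /= formZr; have jr : (j < r)%N by rewrite -dimS.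
by rewrite -(xG (Ordinal jr)) xG0 mxE mulr0.
Qed.

(** The intersection of [S] with [W] lies in that with the orthogonal of P_U S, and the quotient is
    Rad (P_U S). Bounding the larger space by k leaves no room for a radical. *)
Lemma generic_isotropic_dim r k S : (k <= \dim (S :&: W))%N ->
  generic_isotropic B U W r k S <->
  isotropic_gr B r S /\ (\dim (S :&: orthov B (projU U W S)) <= k)%N.
Proof.
move=> kSW; have [UW UW0 _] := dUW.
have SW_sub : (S :&: W <= S :&: orthov B (projU U W S))%VS.
  apply: capvS => //; apply/subvP=> w wW; apply/mem_orthovP=> u /memv_capP[_
    uU].
  by rewrite formC (form_perp dUW).
split=> [[isoS RP dimSW]|[isoS dimSP]].
  split=> //; rewrite -dimSW; apply: dimvS; apply/subvP=> s /memv_capP[sS sP].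
  rewrite memv_cap sS; have [u [w [uU wW defs]]] := perp_decompositionP s dUW.
  have uP : u \in projU U W S.
    by rewrite memv_cap uU andbT -(addrK w u) -defs memv_add ?memvN.
  suff u0 : u = 0 by rewrite defs u0 add0r.
  move/Rad0P: RP; apply=> // y yP; have /memv_capP[_ yU] := yP.
  move/mem_orthovP/(_ y yP): sP; rewrite defs formDl (formC B w).
  by rewrite (form_perp dUW yU wW) addr0.
have defSW : (S :&: W = S :&: orthov B (projU U W S))%VS.
  by apply/eqP; rewrite eqEdim SW_sub (leq_trans dimSP).
split=> //; last by apply/eqP; rewrite eqn_leq kSW defSW dimSP.
apply/Rad0P=> u uP uo; have /memv_capP[/memv_addP[s sS [w wW defu]] uU] := uP.
have : s \in (S :&: W)%VS.
  rewrite defSW memv_cap sS; apply/mem_orthovP=> y yP.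
  have /memv_capP[_ yU] := yP.
  have := uo y yP; rewrite defu formDl (formC B w) (form_perp dUW yU wW).
  by rewrite addr0.
move=> /memv_capP[_ sW]; apply/eqP; rewrite -memv0 -UW0 memv_cap uU.
by rewrite defu memvD.
Qed.

(** In both extreme cases dim (S cap W) is at least k for every [S], since dim P_U S is at most dim
    U. Genericity is then a pure lower bound on a rank. *)
Lemma generic_zariski_open r k :
  (k <= r)%N -> (k = 0 \/ r = k + \dim U)%N ->
  zariski_open B r (generic_isotropic B U W r k).
Proof.
move=> kr k_extreme; apply: (@zariski_open_rank _ _ _ _ projU_form_mx k) => S.
have kSW : \dim S = r -> (k <= \dim (S :&: W))%N.
  move=> dimS; have := dim_projU dUW S; rewrite dimS.
  have : (\dim (projU U W S) <= \dim U)%N by apply/dimvS/capvSr.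
  by case: k_extreme; clear; lia.
have rkE : \dim S = r -> (\dim (S :&: orthov B (projU U W S)) <= k)%N =
  (r <= \rank (coord_matrix r S *m projU_form_mx *m (coord_matrix r S)^T) +
    k)%N.
  by move=> dimS; rewrite (rank_projU_form dimS) leq_subLR.
split=> [genS|[isoS]].
  have [[dimS _] _ _] := genS; rewrite -rkE //.
  by apply/generic_isotropic_dim; first exact: kSW.
by have [dimS _] := isoS; rewrite -rkE // => leqk; apply/generic_isotropic_dim;
  auto.
Qed.

End Openness.

(** * Polynomial functions of one variable *)

Section PolynomialFunctions.

Variable R : comNzRingType.
Implicit Types f g : R -> R.

Definition polyfun f : Prop := exists p : {poly R}, forall t, f t = p.[t].

Lemma polyfun_eq f g : f =1 g -> polyfun g -> polyfun f.
Proof. by move=> fg [p gp]; exists p => t; rewrite fg gp. Qed.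

Lemma polyfun_const c : polyfun (fun=> c).
Proof. by exists c%:P => t; rewrite hornerC. Qed.

Lemma polyfun_id : polyfun id.
Proof. by exists 'X => t; rewrite hornerX. Qed.

Lemma polyfunD f g : polyfun f -> polyfun g -> polyfun (fun t => f t + g t).
Proof. by move=> [p fp] [q gq]; exists (p + q) => t; rewrite hornerD fp gq. Qed.

Lemma polyfunM f g : polyfun f -> polyfun g -> polyfun (fun t => f t * g t).
Proof. by move=> [p fp] [q gq]; exists (p * q) => t; rewrite hornerM fp gq. Qed.

Lemma polyfun_sum (I : Type) (s : seq I) (G : I -> R -> R) :
  (forall i, polyfun (G i)) -> polyfun (fun t => \sum_(i <- s) G i t).
Proof.
move=> Gp; elim: s => [|i s IH].
  by apply: polyfun_eq (polyfun_const 0) => t; rewrite big_nil.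
by apply: polyfun_eq (polyfunD (Gp i) IH) => t; rewrite big_cons.
Qed.

Lemma polyfun_prod (I : Type) (s : seq I) (G : I -> R -> R) :
  (forall i, polyfun (G i)) -> polyfun (fun t => \prod_(i <- s) G i t).
Proof.
move=> Gp; elim: s => [|i s IH].
  by apply: polyfun_eq (polyfun_const 1) => t; rewrite big_nil.
by apply: polyfun_eq (polyfunM (Gp i) IH) => t; rewrite big_cons.
Qed.

Lemma polyfunX f n : polyfun f -> polyfun (fun t => f t ^+ n).
Proof.
move=> fp; apply: (polyfun_eq _ (polyfun_prod (iota 0 n) (fun=> fp))) => t.
by rewrite big_const_seq count_predT size_iota iter_mulr_1.
Qed.

Lemma polyfun_det n (M : R -> 'M[R]_n) :
  (forall i j, polyfun (fun t => M t i j)) -> polyfun (fun t => \det (M t)).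
Proof.
move=> Mp; apply: polyfun_sum => s; apply: polyfunM (polyfun_const _) _.
exact: polyfun_prod.
Qed.

Lemma polyfun_meval n (p : {mpoly R[n]}) (v : R -> 'I_n -> R) :
  (forall i, polyfun (fun t => v t i)) -> polyfun (fun t => p.@[v t]).
Proof.
move=> vp; apply: (polyfun_eq (fun t => mevalE (v t) p)).
apply: polyfun_sum => m; apply: polyfunM (polyfun_const _) _.
by apply: polyfun_prod => i; apply: polyfunX.
Qed.

End PolynomialFunctions.

(** Irreducibility of the affine line: the product of two nonzero polynomials is nonzero, hence has
    a non-root. *)
Lemma polyfun_common_nonzero (F : closedFieldType) (f g : F -> F) :
  polyfun f -> polyfun g -> (exists t, f t != 0) -> (exists t, g t != 0) ->
  exists t, f t * g t != 0.
Proof.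
move=> [p fp] [q gq] [t ft] [t' gt'].
have p0 : p != 0 by apply/eqP=> p0; rewrite fp p0 horner0 eqxx in ft.
have q0 : q != 0 by apply/eqP=> q0; rewrite gq q0 horner0 eqxx in gt'.
have /closed_nonrootP[x] : p * q != 0 by rewrite mulf_neq0.
by rewrite rootE hornerM -fp -gq; exists x.
Qed.

(** * Rational curves in the isotropic Grassmannian *)

Section Curves.

Variables (F : closedFieldType) (V : vectType F) (B : {symmetric V}).
Implicit Types (s : seq V) (S T : {vspace V}).

Local Notation b := (vbasis {:V}).

Definition polycurve (f : F -> V) : Prop :=
  forall j, polyfun (fun t => coord b j (f t)).

Lemma polycurve_const x : polycurve (fun=> x).
Proof. by move=> j; apply: polyfun_const. Qed.

Lemma polycurveD f g :
  polycurve f -> polycurve g -> polycurve (fun t => f t + g t).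
Proof.
move=> fp gp j; apply: polyfun_eq (polyfunD (fp j) (gp j)) => t.
by rewrite linearD.
Qed.

Lemma polycurveZ c f :
  polyfun c -> polycurve f -> polycurve (fun t => c t *: f t).
Proof.
move=> cp fp j; apply: polyfun_eq (polyfunM cp (fp j)) => t.
by rewrite linearZ.
Qed.

Lemma polyfun_form f g :
  polycurve f -> polycurve g -> polyfun (fun t => B (f t) (g t)).
Proof.
move=> fp gp.
have eqB t : B (f t) (g t) =
    \sum_k coord b k (f t) * \sum_l coord b l (g t) * B b`_k b`_l.
  rewrite {1}(coord_vbasis (memvf (f t))) form_suml; apply: eq_bigr => k _.
  rewrite formZl; congr (_ * _); rewrite {1}(coord_vbasis (memvf (g t))).
  by rewrite linear_sumr; apply: eq_bigr => l _; apply: formZr.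
apply: polyfun_eq eqB _; apply: polyfun_sum => k; apply: polyfunM; first exact:
  fp.
by apply: polyfun_sum => l; apply: polyfunM (polyfun_const _); apply: gp.
Qed.

Definition vector_line (u v : V) (t : F) : V := u + t *: (v - u).

Lemma polycurve_line u v : polycurve (vector_line u v).
Proof.
apply: polycurveD; first exact: polycurve_const.
by apply: polycurveZ; [apply: polyfun_id | apply: polycurve_const].
Qed.

Lemma vector_line0 u v : vector_line u v 0 = u.
Proof. by rewrite /vector_line scale0r addr0. Qed.

Lemma vector_line1 u v : vector_line u v 1 = v.
Proof. by rewrite /vector_line scale1r addrC subrK. Qed.

Lemma polycurve_srefls u s x :
  polycurve (fun t => srefls B [seq vector_line u v t | v <- s] x).
Proof.
elim: s => [|v s IH] j /=.
  by apply: polyfun_eq (polyfun_const (coord b j x)) => t; rewrite id_lfunE.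
set f := fun t => srefls B [seq vector_line u v t | v <- s] x in IH *.
pose l := vector_line u v; have lp : polycurve l by apply: polycurve_line.
have fE t : srefls B [seq vector_line u v t | v <- v :: s] x =
    B (l t) (l t) *: f t + (- (2%:R * B (f t) (l t))) *: l t.
  by rewrite /= comp_lfunE sreflE scaleNr.
apply: (@polyfun_eq _ _ _ (fun t => congr1 (coord b j) (fE t))).
apply: (polycurveD (polycurveZ _ IH) (polycurveZ _ lp)); first exact:
  polyfun_form.
have := polyfunM (polyfun_const (- 2%:R)) (polyfun_form IH lp).
by apply: polyfun_eq => t; rewrite mulNr.
Qed.

(** A single polynomial condition expressing that all mirrors are anisotropic. *)
Definition anisotropy s := \prod_(v <- s) B v v.

Lemma anisotropyP s : (anisotropy s != 0) = anisotropic B s.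
Proof.
by rewrite /anisotropy prodf_seq_neq0; apply: eq_all.
Qed.

Lemma polyfun_anisotropy u s :
  polyfun (fun t => anisotropy [seq vector_line u v t | v <- s]).
Proof.
apply: polyfun_eq (polyfun_prod s (fun v =>
  polyfun_form (polycurve_line u v) (polycurve_line u v))) => t.
by rewrite /anisotropy big_map.
Qed.

Lemma srefls_nseq_double u n x :
  srefls B (nseq n.*2 u) x = (B u u ^+ 2) ^+ n *: x.
Proof.
elim: n => [|n IH]; first by rewrite id_lfunE expr0 scale1r.
by rewrite doubleS /= !comp_lfunE sreflK IH scalerA -exprS.
Qed.

Lemma refls_lker0 s : nondegenerate B -> anisotropic B s -> lker (refls B s) ==
  0%VS.
Proof.
move=> B_nondeg s0; rewrite -subv0; apply/subvP=> x.
rewrite memv_ker memv0 => /eqP x0; apply/eqP/(form_eq0 B_nondeg)=> y.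
by rewrite -(refls_form _ _ s0) x0 linear0l.
Qed.

Lemma isotropic_gr_refls r s S : nondegenerate B -> anisotropic B s ->
  isotropic_gr B r S -> isotropic_gr B r (refls B s @: S).
Proof.
move=> B_nondeg s0 [dimS /orthovP SS]; split.
  by rewrite limg_dim_eq ?dimS // (eqP (refls_lker0 B_nondeg s0)) capv0.
apply/orthovP=> _ _ /memv_imgP[x xS ->] /memv_imgP[y yS ->].
by rewrite refls_form ?SS.
Qed.

(** One of the equations of the closed complement fails at [T]; its non-vanishing locus is a basic
    open neighbourhood inside [X]. *)
Lemma zariski_open_witness r (X : {vspace V} -> Prop) T :
  zariski_open B r X -> X T ->
  exists p : {mpoly F[#|plucker_index V r|]}, exists2 d, p \is d.-homog
    & p.@[plucker T] != 0 /\
      forall S, isotropic_gr B r S -> p.@[plucker S] != 0 -> X S.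
Proof.
move=> [Xiso [P [Phomog defX]]] XT.
have [p pP pT] : exists2 p, P p & p.@[plucker T] != 0.
  apply: NNPP => nop; suff [_ /(_ XT)] : isotropic_gr B r T /\ ~ X T by [].
  apply/defX; split=> [|p pP]; first exact: Xiso.
  by apply/eqP/negPn/negP=> nz; apply: nop; exists p.
have [d p_homog] := Phomog p pP; exists p, d => //; split=> // S isoS pS.
apply: NNPP => nXS; have [_ /(_ p pP) pS0] := iffLR (defX S) (conj isoS nXS).
by rewrite pS0 eqxx in pS.
Qed.

(** The minors of the moved basis of [S] are polynomial in t and differ from the Plücker coordinates
    by a common nonzero factor, which the homogeneous [p] does not detect. *)
Lemma polyfun_plucker r u s S (p : {mpoly F[#|plucker_index V r|]}) d :
  nondegenerate B -> isotropic_gr B r S -> p \is d.-homog ->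
  exists2 f : F -> F, polyfun f &
    forall t, anisotropic B [seq vector_line u v t | v <- s] ->
      (p.@[plucker (srefls B [seq vector_line u v t | v <- s] @: S)] != 0)
        = (f t != 0).
Proof.
move=> B_nondeg isoS p_homog; have [dimS _] := isoS.
pose X := tcast dimS (vbasis S).
pose g t := srefls B [seq vector_line u v t | v <- s].
pose Xt t := map_tuple (g t) X.
exists (fun t => p.@[fun k : 'I_#|plucker_index V r| =>
                       \det (colsub (enum_val k) (tuple_matrix (Xt t)))]).
  apply: polyfun_meval => k; apply: polyfun_det => i j.
  have := polycurve_srefls u s X`_i (enum_val k j).
  apply: polyfun_eq => t; rewrite !mxE (nth_map 0) //.
  by rewrite size_tuple.
move=> t ant; rewrite -/(g t).
have spanXt : <<Xt t>>%VS = (g t @: S)%VS.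
  by rewrite -limg_span val_tcast (span_basis (vbasisP S)).
have [dimgS _] : isotropic_gr B r (g t @: S).
  by rewrite -refls_limg //; apply: isotropic_gr_refls.
have [c c0 pE] := plucker_span dimgS spanXt.
rewrite (meval_eq _ pE) (meval_homog_scale _ _ p_homog).
by rewrite mulf_eq0 expf_eq0 (negPf c0) andbF.
Qed.

(* S and T are joined by the images of S under products of reflections in
   vectors moving along lines that start at u: at t = 0 the product is a
   scalar, since its length is even. *)
Lemma zariski_open_meet r (X Y : {vspace V} -> Prop) S T u s :
  nondegenerate B -> zariski_open B r X -> zariski_open B r Y ->
  X T -> Y S -> B u u != 0 -> anisotropic B s -> ~~ odd (size s) ->
  (refls B s @: S)%VS = T ->
  exists2 Z, X Z & Y Z.
Proof.
move=> B_nondeg openX openY XT YS u0 s0 even_s sST.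
have isoS := openY.1 S YS.
have [p [d p_homog [pT pX]]] := zariski_open_witness openX XT.
have [q [e q_homog [qS qY]]] := zariski_open_witness openY YS.
pose st t := [seq vector_line u v t | v <- s].
have st0 : st 0 = nseq (size s)./2.*2 u.
  rewrite even_halfK //; rewrite /st; clear.
  by elim: s => //= v s ->; rewrite vector_line0.
have st1 : st 1 = s.
  by rewrite -[RHS]map_id; apply: eq_map => v; apply: vector_line1.
have an0 : anisotropic B (st 0).
  by rewrite st0; apply/allP=> v /nseqP[->].
have [f fp fE] := polyfun_plucker u s B_nondeg isoS p_homog.
have [g gp gE] := polyfun_plucker u s B_nondeg isoS q_homog.
have f1 : exists t, f t != 0.
  by exists 1; rewrite -fE -/(st 1) st1 // -refls_limg // sST.
have g0 : exists t, g t != 0.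
  exists 0; rewrite -gE // -/(st 0) st0.
  have -> : srefls B (nseq (size s)./2.*2 u) = (B u u ^+ 2) ^+ (size s)./2 *:
    \1%VF.
    by apply/lfunP=> x; rewrite srefls_nseq_double scale_lfunE id_lfunE.
  by rewrite limg_scale ?lim1g // !expf_neq0.
have a0 : exists t, anisotropy (st t) != 0 by exists 0; rewrite anisotropyP.
(* Some t keeps all mirrors anisotropic, so that the image of [S] is isotropic of dimension r, and
   puts this image into both [X] and [Y]. *)
have fg0 := polyfun_common_nonzero fp gp f1 g0.
have [t] := polyfun_common_nonzero (polyfun_anisotropy u s) (polyfunM fp gp) a0
  fg0.
rewrite !mulf_eq0 !negb_or anisotropyP => /and3P[ant ft gt].
have isoZ : isotropic_gr B r (srefls B (st t) @: S).
  by rewrite -refls_limg //; apply: isotropic_gr_refls.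
by exists (srefls B (st t) @: S)%VS; [apply: pX | apply: qY]; rewrite ?fE ?gE.
Qed.

End Curves.

(** * Uniqueness of the open orbit and its invariants *)

Section UniqueOpenOrbit.

Variables (F : closedFieldType) (V : vectType F) (B : {symmetric V}).
Hypothesis char_F : 2%N \notin [pchar F].
Hypothesis B_nondeg : nondegenerate B.
Implicit Types (U W S T : {vspace V}) (X Y : {vspace V} -> Prop).

Lemma isotropic_refls r S T : isotropic_gr B r S -> isotropic_gr B r T ->
  exists2 s, anisotropic B s & (refls B s @: S)%VS = T.
Proof.
move=> [dimS SS] [dimT TT]; have [im im2] := sqrt_closed (-1 : F).
have Rf : Rad B fullv = 0%VS by rewrite /Rad capfv (eqP B_nondeg).
have [x [y [sx sy _ xy1 ->]]] := isotropic_isozip char_F im2 Rf (subvf S) SS.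
have [x' [y' [sx' sy' _ xy'1 ->]]] := isotropic_isozip char_F im2 Rf (subvf T)
  TT.
have sz : size (x ++ y) = size (x' ++ y').
  by rewrite !size_cat sx sy sx' sy' dimS dimT.
have full (s : seq V) : {subset s <= {:V}%VS} by move=> z _; apply: memvf.
have [s [s0 _]] := orthonormal_refls char_F sz xy1 xy'1 (full _) (full _).
rewrite map_cat => /eqP; rewrite eqseq_cat; last first.
  by rewrite size_map sx sx' dimS dimT.
case/andP=> /eqP sxx' /eqP syy'; exists s => //.
by rewrite limg_span map_isozip sxx' syy'.
Qed.

Lemma H_orbit_eq U W r X Y S : perp_decomposition B U W ->
  is_H_orbit B U W r X -> is_H_orbit B U W r Y -> X S -> Y S ->
  forall T, X T -> Y T.
Proof.
move=> dUW [S1 _ defX] [S2 _ defY] /defX[h hH defS] /defY[h' h'H defS'] T.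
(* As [S] is both h S1 and h' S2, the subspace a S1 is the image of S2 under a h^-1 h'. *)
case/defX=> a aH ->; apply/defY; exists (a \o (h^-1 \o h'))%VF.
  by do 2?[apply: in_H_comp => //]; apply: in_H_inv hH.
have h0 := in_H_lker0 B_nondeg dUW hH.
by rewrite !limg_comp -defS' defS -(limg_comp h) lker0_compVf // lim1g.
Qed.

Lemma generic_unique_open U W r k :
  perp_decomposition B U W -> U != 0%VS ->
  (k <= r)%N -> (r <= k + \dim U)%N -> (r + k <= \dim W)%N ->
  (k = 0 \/ r = k + \dim U)%N ->
  unique_open_H_orbit B U W r (generic_isotropic B U W r k).
Proof.
move=> dUW U0 kr rU rW k_extreme; have [im im2] := sqrt_closed (-1 : F).
have orbX := generic_H_orbit char_F im2 B_nondeg dUW kr rU rW.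
have openX := generic_zariski_open dUW kr k_extreme.
split=> // Y orbY openY.
have [u uU u0] := anisotropic_vector char_F (Rad_summand B_nondeg dUW) U0.
have [T isoT defX] := orbX.
have XT : generic_isotropic B U W r k T.
  apply/defX; exists \1%VF; rewrite ?lim1g //.
  have -> : \1%VF = refls B [::] by [].
  exact: (in_H_refls B_nondeg dUW).
have [S isoS defY] := orbY.
have YS : Y S.
  apply/defY; exists \1%VF; rewrite ?lim1g //.
  have -> : \1%VF = refls B [::] by [].
  exact: (in_H_refls B_nondeg dUW).
have [s s0 sST] := isotropic_refls isoS isoT.
have [Z XZ YZ] : exists2 Z, generic_isotropic B U W r k Z & Y Z.
  have [odd_s|even_s] := boolP (odd (size s)); last first.
    exact: (zariski_open_meet B_nondeg openX openY XT YS u0 s0 even_s sST).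
  (* The extra mirror [u] makes the length even and replaces [T] by its reflection, which lies in
     the same H-orbit. *)
  have us0 : anisotropic B (u :: s) by rewrite /= u0.
  have XuT : generic_isotropic B U W r k (refls B [:: u] @: T).
    apply/defX; exists (refls B [:: u]) => //.
    apply: (in_H_refls B_nondeg dUW); first by rewrite /= u0.
    by move=> z /[!inE] /eqP ->.
  apply: (zariski_open_meet B_nondeg openX openY XuT YS u0 us0).
    by rewrite /= odd_s.
  by rewrite -cat1s refls_cat limg_comp sST.
by split; apply: (@H_orbit_eq U W r _ _ Z).
Qed.

Lemma is_H_orbitC U W r X : is_H_orbit B U W r X -> is_H_orbit B W U r X.
Proof.
move=> [S isoS defX]; exists S => // T; split=> [/defX[h]|[h]] /in_HC hH ->.
  by exists h.
by apply/defX; exists h.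
Qed.

Lemma unique_open_H_orbitC U W r X :
  unique_open_H_orbit B U W r X -> unique_open_H_orbit B W U r X.
Proof.
move=> [orbX openX uniqX]; split=> // [|Y orbY openY]; first exact: is_H_orbitC.
by apply: uniqX => //; apply: is_H_orbitC.
Qed.

Lemma unique_open_H_orbit_ext U W r X Y : (forall S, X S <-> Y S) ->
  unique_open_H_orbit B U W r X -> unique_open_H_orbit B U W r Y.
Proof.
move=> XY [[T isoT defX] [isoX [P [Ph defP]]] uniqX]; split.
- by exists T => // S; rewrite -XY.
- split=> [S /XY /isoX //|]; exists P; split=> // S; rewrite -defP XY //.
by move=> Z orbZ openZ S; rewrite -XY; apply: uniqX.
Qed.

Lemma orbitO_generic U W r k S : perp_decomposition B U W -> (k <= r)%N ->
  generic_isotropic B U W r k S <-> orbitO B U W r 0 k 0 (r - k) S.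
Proof.
move=> dUW kr; have [_ _ oUW] := dUW; have dimP := dim_projU dUW S.
rewrite /orbitO /dim_a /dim_b /dim_rU /dim_rW.
split=> [[isoS RP dimSW]|[isoS [dimSU dimSW]]]; have [dimS _] := isoS.
  have := dimvS (capv_sub_Rad_projU oUW isoS).
  rewrite RP dimv0 leqn0 => /eqP dimSU; split=> //; split=> //.
  by rewrite subn0 -dimS -dimP dimSW addnK.
(* With r_U = 0 the truncated subtraction in [dim_a] is exact, so a = 0 kills the radical. *)
by rewrite dimSU subn0 => /eqP; rewrite dimv_eq0 => /eqP RP _.
Qed.

(** If x = s + w is in Rad (P_U S) with s in [S] and w in [W], isotropy of [S] makes w orthogonal to
    P_W S. So w is in Rad (P_W S) = 0 and x is in [S]. *)
Lemma Rad_projU_swap U W r S : perp_decomposition B U W -> isotropic_gr B r S ->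
  Rad B (projU W U S) = 0%VS -> Rad B (projU U W S) = (S :&: U)%VS.
Proof.
move=> dUW isoS /Rad0P RP; have [_ _ oUW] := dUW; have [_ /orthovP SS] := isoS.
apply/eqP; rewrite eqEsubv (capv_sub_Rad_projU oUW isoS) andbT.
apply/subvP=> x /RadP[/memv_capP[/memv_addP[s sS [w wW defx]] xU] xo].
have defs : s = x - w by rewrite defx addrK.
suff w0 : w = 0 by rewrite memv_cap xU defx w0 addr0 sS.
apply: RP => [|y /memv_capP[/memv_addP[s' s'S [u' u'U defy]] yW]].
  by rewrite memv_cap wW andbT -(addKr s w) -defx memv_add ?memvN.
have u'P : u' \in projU U W S.
  by rewrite memv_cap u'U andbT -(addKr s' u') -defy memv_add ?memvN.
have := SS _ _ sS s'S; rewrite defs -[s'](addrK u') -defy !formE.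
rewrite (form_perp dUW xU yW) xo // (formC B w u') (form_perp dUW u'U wW).
by rewrite !(oppr0, addr0, add0r) => /eqP; rewrite oppr_eq0 => /eqP.
Qed.

(** Conversely, r_U = r - dim W forces P_W S = W by [dim_projU], and [W] is nondegenerate. *)
Lemma orbitO_generic_swap U W r S : perp_decomposition B U W ->
  (\dim W <= r)%N ->
  generic_isotropic B W U r (r - \dim W)%N S <->
  orbitO B U W r (r - \dim W)%N 0 0 (\dim W) S.
Proof.
move=> dUW Wr; have dWU := perp_decompositionC dUW.
have [_ _ oUW] := dUW; have [_ _ oWU] := dWU.
have dimP := dim_projU dUW S; have dimQ := dim_projU dWU S.
rewrite /orbitO /dim_a /dim_b /dim_rU /dim_rW.
split=> [[isoS RQ dimSU]|[isoS [dimSU dimSW _ _]]]; have [dimS _] := isoS.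
  rewrite (Rad_projU_swap dUW isoS RQ) dimSU subnn; split=> //.
  have := dimvS (capv_sub_Rad_projU oWU isoS).
  by rewrite RQ dimv0 leqn0 => /eqP dimSW; split=> //; clear -dimP dimSU dimSW
    dimS Wr; lia.
split=> //; suff -> : projU W U S = W by apply: Rad_summand dWU.
by apply/eqP; rewrite eqEdim capvSr; clear -dimQ dimSU dimS Wr; lia.
Qed.

End UniqueOpenOrbit.

(* The choice of k and of the summand in each case *)
Local Close Scope ring_scope.

Theorem corollary4p4 (F : closedFieldType) (char_F : 2%N \notin [pchar F]%R)
    (n m r : nat) (V : vectType F) (dim_V : \dim {:V} = n)
    (B : {symmetric V}%R) (B_nondeg : nondegenerate B)
    (U W : {vspace V})
    (V_UW : (U + W = fullv)%VS) (UW_direct : (U :&: W = 0)%VS)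
    (UW_perp : (U <= orthov B W)%VS)
    (dim_U : \dim U = m) (dim_W : \dim W = n - m)
    (m_gt0 : 0 < m) (m_ltn : m < n) (r_le : r <= n./2) :
  (r <= minn m (n - m) ->
     unique_open_H_orbit B U W r (orbitO B U W r 0 0 0 r))
  /\
  (minn m (n - m) <= r ->
     unique_open_H_orbit B U W r
       (if \dim U <= \dim W
        then orbitO B U W r 0 (r - m) 0 m
        else orbitO B U W r (r - (n - m)) 0 0 (n - m))).
Proof.
have dUW : perp_decomposition B U W by split.
have U0 : U != 0%VS by rewrite -dimv_eq0 dim_U -lt0n.
have W0 : W != 0%VS by rewrite -dimv_eq0 dim_W; lia.
split=> [r_small|r_large].
  have := orbitO_generic (k := 0) _ dUW (leq0n r); rewrite subn0 => eqX.
  apply: (unique_open_H_orbit_ext eqX).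
  by apply: generic_unique_open; rewrite ?dim_U ?dim_W //; [lia.. | left].
case: ifP => UW_le.
  have mr : m <= r by lia.
  have := orbitO_generic (k := r - m) _ dUW (leq_subr m r).
  rewrite subKn // => eqX; apply: (unique_open_H_orbit_ext eqX).
  (* With k = r - m, the condition r + k <= dim W says 2r <= n. *)
  by apply: generic_unique_open; rewrite ?dim_U ?dim_W //; [lia.. | right; lia].
have mr : \dim W <= r by lia.
(* The smaller summand is now [W], so [U] and [W] exchange roles and k = r - dim W. *)
have eqX S := orbitO_generic_swap B_nondeg S dUW mr; rewrite -dim_W.
apply: (unique_open_H_orbit_ext eqX); apply: unique_open_H_orbitC.
have dWU := perp_decompositionC dUW.
by apply: generic_unique_open; rewrite ?dim_U ?dim_W //; [lia.. | right; lia].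
Qed.
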